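(* Let $f(x)=\mathbb{E}_\xi[F(x,\xi)]$ on $\mathbb{R}^d$, and assume $\mathbb{E}[(F(x,\xi)-f(x))^2]\le\sigma^2$ for all $x\in\mathbb{R}^d$, for some $\sigma>0$. Assume that for every $\xi$ the function $F(\cdot,\xi)$ is convex and Lipschitz continuous with constant $L_0(\xi)\le L_0$, where $L_0>0$. Let $x^\ast$ be a global minimizer of $f$. Run the zeroth-order iteration $x_{t+1}=x_t-\eta\,\tilde g(x_t)$ with stochastic one-point residual feedback (defined in the context) for $T$ iterations and let $\bar x=\frac1T\sum_{t=0}^{T-1}x_t$. (i) If $\eta=\frac{1}{2\sqrt2\,L_0\sqrt d\,T^{3/4}}$ and $\delta=\frac{1}{T^{1/4}}$, then $$\mathbb{E}[f(\bar x)]-f(x^\ast)=\mathcal{O}\big(\sqrt d\,T^{-1/4}\big).$$ (ii) If additionally for every $\xi$ the function $F(\cdot,\xi)$ is differentiable with Lipschitz continuous gradient with constant $L_1(\xi)\le L_1$, where $L_1>0$, and $\eta=\frac{1}{2\sqrt2\,L_0\,d^{2/3}T^{2/3}}$, $\delta=\frac{1}{d^{1/6}T^{1/6}}$, then $$\mathbb{E}[f(\bar x)]-f(x^\ast)=\mathcal{O}\big(d^{2/3}\,T^{-1/3}\big).$$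
   Context: Stochastic residual feedback: $x_0\in\mathbb{R}^d$ is a given deterministic point, $u_0,u_1,\dots$ are i.i.d. standard Gaussian vectors in $\mathbb{R}^d$, $\xi_0,\xi_1,\dots$ are i.i.d. data samples distributed as $\xi$ and independent of all the $u_t$, $\delta>0$ is the exploration parameter and $\eta>0$ the stepsize. For $t\ge1$, $$\tilde g(x_t)=\frac{u_t}{\delta}\big(F(x_t+\delta u_t,\xi_t)-F(x_{t-1}+\delta u_{t-1},\xi_{t-1})\big),$$ and at $t=0$, $\tilde g(x_0)=\frac{u_0}{\delta}F(x_0+\delta u_0,\xi_0)$. The iterates are $x_{t+1}=x_t-\eta\,\tilde g(x_t)$. Meaning of $\mathcal{O}$ (leading order as $T\to\infty$): for all $T\ge T_0$, where the threshold $T_0$ may depend on $d$, the left side is at most $C$ times the displayed rate, where $C$ depends only on $L_0$, $\sigma$, $\|x_0-x^\ast\|$, $\mathbb{E}[\|\tilde g(x_0)\|^2]$ and, in (ii), also $L_1$ (no further dependence on $d,T$). *)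

(* Defs.v *)
From HB Require Import structures.
From mathcomp Require Import all_boot all_order all_algebra.
From mathcomp Require Import all_classical all_reals all_analysis.

Set Implicit Arguments.
Unset Strict Implicit.
Unset Printing Implicit Defensive.

Import Order.TTheory GRing.Theory Num.Theory.
Import numFieldNormedType.Exports.

Local Open Scope classical_set_scope.
Local Open Scope ring_scope.

(* The library norm on ['rV[R]_d] is the sup norm, hence an explicit
   Euclidean norm. *)
Definition enorm (R : realType) (d : nat) (x : 'rV[R]_d) : R :=
  Num.sqrt (\sum_(i < d) x 0 i ^+ 2).

Definition gradient (R : realType) (d : nat) (h : 'rV[R]_d -> R)
    (x : 'rV[R]_d) : 'rV[R]_d :=
  \row_(i < d) 'D_(delta_mx 0 i) h x.

Definition mutually_independent (dO : measure_display)
    (Omega : measurableType dO) (R : realType) (P : probability Omega R)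
    (I : eqType) (E : I -> set (set Omega)) : Prop :=
  forall (s : seq I) (A : I -> set Omega),
    uniq s -> (forall i, i \in s -> E i (A i)) ->
    P (\big[setI/setT]_(i <- s) A i) = (\prod_(i <- s) P (A i))%E.

Definition std_gaussian_vector (dO : measure_display)
    (Omega : measurableType dO) (R : realType) (P : probability Omega R)
    (d : nat) (v : Omega -> 'rV[R]_d) : Prop :=
  [/\ forall i, measurable_fun setT (fun w => v w 0 i),
      mutually_independent P (fun i : 'I_d =>
        preimage_set_system setT (fun w => v w 0 i) measurable)
    & forall i (B : set R), measurable B ->
        P ((fun w => v w 0 i) @^-1` B) = normal_prob 0 1 B].

(* The law [Q] on [Xi] plays the role of the generic sample "xi". *)
Definition objective (dX : measure_display) (Xi : measurableType dX)
    (R : realType) (Q : probability Xi R) (d : nat)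
    (F : 'rV[R]_d -> Xi -> R) (x : 'rV[R]_d) : R :=
  fine ('E_Q[F x])%E.

Record convex_stochastic_objective (dX : measure_display)
    (Xi : measurableType dX) (R : realType) (Q : probability Xi R) (d : nat)
    (F : 'rV[R]_d -> Xi -> R) (L0 sigma : R) : Prop := {
  cso_integrable : forall x, Q.-integrable setT (EFin \o F x);
  cso_variance : forall x,
    ('E_Q[fun z => ((F x z - objective Q F x) ^+ 2)%R] <= (sigma ^+ 2)%:E)%E;
  cso_convex : forall z, convex_function setT (fun x : 'rV[R]_d => F x z);
  cso_lipschitz : forall z, exists2 L0z : R, L0z <= L0 &
    forall x y, `|F x z - F y z| <= L0z * enorm (x - y)
}.

Definition smooth_samples (Xi : Type) (R : realType) (d : nat)
    (F : 'rV[R]_d -> Xi -> R) (L1 : R) : Prop :=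
  forall z, (forall x, differentiable (fun y : 'rV[R]_d => F y z) x) /\
    exists2 L1z : R, L1z <= L1 &
      forall x y, enorm (gradient (fun y => F y z) x
                         - gradient (fun y => F y z) y) <= L1z * enorm (x - y).

(* [u t] are standard Gaussian and [xi t] have law [Q]; the whole family of
   sigma-algebras sigma(u_0), sigma(u_1), ..., sigma(xi_0), sigma(xi_1), ... is
   mutually independent, so that each sequence is i.i.d. and the two sequences
   are independent of each other. *)
Record sampling_noise (dO dX : measure_display) (Omega : measurableType dO)
    (Xi : measurableType dX) (R : realType) (P : probability Omega R)
    (Q : probability Xi R) (d : nat)
    (u : nat -> Omega -> 'rV[R]_d) (xi : nat -> Omega -> Xi) : Prop := {
  sn_gaussian : forall t, std_gaussian_vector P (u t);
  sn_measurable : forall t, measurable_fun setT (xi t);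
  sn_law : forall t (B : set Xi), measurable B -> P (xi t @^-1` B) = Q B;
  sn_independent : mutually_independent P (fun k : nat + nat =>
    match k with
    | inl t => g_sigma_preimage (fun (i : 'I_d) w => u t w 0 i)
    | inr t => preimage_set_system setT (xi t) measurable
    end)
}.

Definition residual_estimator (Omega Xi : Type) (R : realType) (d : nat)
    (F : 'rV[R]_d -> Xi -> R) (delta : R) (u : nat -> Omega -> 'rV[R]_d)
    (xi : nat -> Omega -> Xi) (x : nat -> Omega -> 'rV[R]_d)
    (t : nat) (w : Omega) : 'rV[R]_d :=
  let query s := F (x s w + delta *: u s w) (xi s w) in
  match t with
  | 0%N => (query 0%N / delta) *: u 0%N w
  | s.+1 => ((query s.+1 - query s) / delta) *: u s.+1 w
  end.

Definition residual_feedback_run (Omega Xi : Type) (R : realType) (d : nat)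
    (F : 'rV[R]_d -> Xi -> R) (eta delta : R) (x0 : 'rV[R]_d)
    (u : nat -> Omega -> 'rV[R]_d) (xi : nat -> Omega -> Xi)
    (x : nat -> Omega -> 'rV[R]_d) : Prop :=
  (forall w, x 0%N w = x0) /\
  (forall t w, x t.+1 w = x t w - eta *: residual_estimator F delta u xi x t w).

Definition average_iterate (Omega : Type) (R : realType) (d : nat) (T : nat)
    (x : nat -> Omega -> 'rV[R]_d) (w : Omega) : 'rV[R]_d :=
  T%:R^-1 *: \sum_(t < T) x t w.

Definition initial_second_moment (dO : measure_display)
    (Omega : measurableType dO) (Xi : Type) (R : realType)
    (P : probability Omega R) (d : nat) (F : 'rV[R]_d -> Xi -> R) (delta : R)
    (u : nat -> Omega -> 'rV[R]_d) (xi : nat -> Omega -> Xi)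
    (x : nat -> Omega -> 'rV[R]_d) : R :=
  fine ('E_P[fun w =>
    (enorm (residual_estimator F delta u xi x 0%N w) ^+ 2)%R])%E.

(* Main.v *)
(* A Gaussian shift is the change of density exp (s U - s^2 / 2), so a Lipschitz
   function Phi of a standard normal U satisfies Stein's identity
   E Phi(U + s) - E Phi(U) = s E[U Phi(U)] up to O(s^2).  Apply it to each
   coordinate of u_t conditionally on all the other noise, and combine it with
     G(y) - G(y - v) <= sum_i (G(y + r v_i e_i) - G(y)) / r,
   valid for convex G and every r > 0; letting r tend to 0 gives
     E <g_t, x_t - x*> >= E F(x_t + delta u_t, xi_t) - E F(x* + delta u_t, xi_t)
   with no smoothed objective to differentiate: the residual F(x_{t-1} + ...)
   in g_t is independent of u_t, hence contributes nothing.  Moreover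
   E |g_{t+1}|^2 <= alpha E |g_t|^2 + K with alpha <= 1/2, so that telescoping
   |x_t - x*|^2 bounds the regret of the perturbed queries.  The bias of the
   perturbation is at most L0 delta sqrt d by the Lipschitz property and
   L1 delta^2 d in the smooth case, where the first order term has mean 0. *)

Require Import Defs.
From HB Require Import structures.
From mathcomp Require Import all_boot all_order all_algebra.
From mathcomp Require Import all_classical all_reals all_analysis.
From mathcomp Require Import measurable_realfun.
From mathcomp Require Import ring lra.

Set Implicit Arguments.
Unset Strict Implicit.
Unset Printing Implicit Defensive.
Set SsrOldRewriteGoalsOrder.

Import Order.TTheory GRing.Theory Num.Theory.
Import numFieldNormedType.Exports.

Local Open Scope classical_set_scope.
Local Open Scope ring_scope.

(** * Integrals of real functions *)

(** The hypotheses give measurability of [F x] only for each fixed [x], while the argument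
    integrates [F] at random points; joint measurability has to be recovered from the Lipschitz
    property. Conditioning is done without conditional expectations: the component singled out is
    independent of the sigma-algebra generated by all the other components, so Fubini for the pair
    integrates it out with the rest frozen. The shift applied to a coordinate of [u t] is a multiple
    of a coordinate of [x t - xstar], hence random and unbounded. Therefore the error in Stein's
    identity must be quadratic for every shift, small or large, and the second moments of the
    iterates must be known to be finite before [r] tends to 0. For both choices of parameters
    [alpha] equals [1 / (2 T)]. The additive constant of the recursion contains the fourth moment of
    the Gaussian, and this term alone forces [T] to be large in terms of [d]. *)

Definition integ d (T : measurableType d) (R : realType)
    (mu : {measure set T -> \bar R}) (f : T -> R) : Prop :=
  mu.-integrable setT (EFin \o f).

Section integ_general.
Context d (T : measurableType d) (R : realType).
Variable mu : {measure set T -> \bar R}.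
Implicit Types f g : T -> R.
Local Notation integ := (integ mu).

Lemma integ_meas f : integ f -> measurable_fun setT f.
Proof. by move=> /measurable_int /measurable_EFinP. Qed.

Lemma integD f g : integ f -> integ g -> integ (fun x => f x + g x).
Proof. by move=> hf hg; exact: (integrableD measurableT hf hg). Qed.

Lemma integB f g : integ f -> integ g -> integ (fun x => f x - g x).
Proof. by move=> hf hg; exact: (integrableB measurableT hf hg). Qed.

Lemma integZ c f : integ f -> integ (fun x => c * f x).
Proof. by move=> hf; exact: (integrableZl measurableT c hf). Qed.

Lemma integ_sum (I : Type) (r : seq I) (f : I -> T -> R) :
  (forall i, integ (f i)) -> integ (fun x => \sum_(i <- r) f i x).
Proof.
move=> hf; elim: r => [|a r ih].
  rewrite /integ (_ : EFin \o _ = cst 0%E); first exact: integrable0.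
  by apply/funext => x /=; rewrite big_nil.
have -> : (fun x => \sum_(i <- a :: r) f i x)
  = (fun x => f a x + \sum_(i <- r) f i x).
  by apply/funext => x; rewrite big_cons.
exact: integD.
Qed.

Lemma integ_le f g : measurable_fun setT f -> (forall x, `|f x| <= g x) ->
  integ g -> integ f.
Proof.
move=> mf fg; apply: le_integrable => //; first exact/measurable_EFinP.
by move=> x _ /=; rewrite lee_fin (le_trans (fg x))// ler_norm.
Qed.

Lemma integ_norm f : integ f -> integ (fun x => `|f x|).
Proof. by move=> hf; exact: (integrable_abse hf). Qed.

Lemma integ_ge0 f : measurable_fun setT f -> (forall x, 0 <= f x) ->
  (\int[mu]_x (f x)%:E < +oo)%E -> integ f.
Proof.
move=> mf f0 h; apply/integrableP; split; first exact/measurable_EFinP.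
by under eq_integral do rewrite /= ger0_norm//.
Qed.

Lemma integ_mulsq f g : measurable_fun setT f -> measurable_fun setT g ->
  integ (fun x => f x ^+ 2) -> integ (fun x => g x ^+ 2) ->
  integ (fun x => f x * g x).
Proof.
move=> mf mg hf hg.
apply: (integ_le _ _ (integD hf hg)); first exact: measurable_funM.
move=> x; rewrite normrM -(real_normK (num_real (f x))).
rewrite -(real_normK (num_real (g x))).
have := sqr_ge0 (`|f x| - `|g x|).
have := mulr_ge0 (normr_ge0 (f x)) (normr_ge0 (g x)); nra.
Qed.

Lemma Ex_EFin f : integ f -> ((\int[mu]_x f x)%:E = \int[mu]_x (f x)%:E)%E.
Proof. by move=> hf; rewrite /Rintegral fineK//; exact: integrable_fin_num. Qed.

Lemma ExD f g : integ f -> integ g ->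
  \int[mu]_x (f x + g x) = \int[mu]_x f x + \int[mu]_x g x.
Proof. by move=> hf hg; exact: RintegralD. Qed.

Lemma ExB f g : integ f -> integ g ->
  \int[mu]_x (f x - g x) = \int[mu]_x f x - \int[mu]_x g x.
Proof. by move=> hf hg; exact: RintegralB. Qed.

Lemma ExZ c f : integ f -> \int[mu]_x (c * f x) = c * \int[mu]_x f x.
Proof. by move=> hf; exact: RintegralZl. Qed.

Lemma Ex_sum (I : Type) (r : seq I) (f : I -> T -> R) :
  (forall i, integ (f i)) ->
  \int[mu]_x (\sum_(i <- r) f i x) = \sum_(i <- r) \int[mu]_x f i x.
Proof.
move=> hf; elim: r => [|a r ih].
  rewrite big_nil; under eq_Rintegral do rewrite big_nil.
  by rewrite /Rintegral integral0.
rewrite big_cons; under eq_Rintegral do rewrite big_cons.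
by rewrite ExD ?ih//; exact: integ_sum.
Qed.

Lemma Ex_le f g : integ f -> integ g -> (forall x, f x <= g x) ->
  \int[mu]_x f x <= \int[mu]_x g x.
Proof. by move=> hf hg fg; exact: le_Rintegral. Qed.

Lemma eq_Ex f g : f =1 g -> \int[mu]_x f x = \int[mu]_x g x.
Proof. by move=> /funext ->. Qed.

End integ_general.

Section integ_probability.
Context d (T : measurableType d) (R : realType) (P : probability T R).
Implicit Types f g : T -> R.

Lemma integ_cst c : integ P (fun=> c).
Proof. exact: finite_measure_integrable_cst. Qed.

Lemma Ex_cst c : \int[P]_x c = c.
Proof. by rewrite Rintegral_cst//= probability_setT mulr1. Qed.

Lemma integ_sq f : measurable_fun setT f -> integ P (fun x => f x ^+ 2) ->
  integ P f.
Proof.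
move=> mf hf; apply: (integ_le mf _ (integD hf (integ_cst 1))) => x /=.
rewrite -(real_normK (num_real (f x))).
have := sqr_ge0 (`|f x| - 1); have := normr_ge0 (f x); nra.
Qed.

End integ_probability.

(** * The standard normal law *)

Section std_normal.
Variable R : realType.

(* [normal_prob 0 1] on the type [R] with its default measurable structure
   instead of [measurableTypeR R]. *)
Definition std_normal (A : set R) : \bar R := normal_prob 0 1 A.

Let std_normal0 : std_normal set0 = 0%E.
Proof. exact: measure0. Qed.

Let std_normal_ge0 A : (0 <= std_normal A)%E.
Proof. exact: measure_ge0. Qed.

Let std_normal_sigma_additive : semi_sigma_additive std_normal.
Proof. exact: (@measure_semi_sigma_additive _ _ _ (normal_prob 0 1)). Qed.

HB.instance Definition _ := isMeasure.Build _ _ _ std_normal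
  std_normal0 std_normal_ge0 std_normal_sigma_additive.

Let std_normal_setT : std_normal [set: R] = 1%E.
Proof. exact: (@probability_setT _ _ _ (normal_prob 0 1)). Qed.

HB.instance Definition _ :=
  @Measure_isProbability.Build _ _ R std_normal std_normal_setT.

End std_normal.

Section gaussian.
Variable R : realType.
Implicit Types (s x : R) (f : R -> R).
Local Notation lam := (@lebesgue_measure R).
Local Notation N := (@std_normal R).
Local Notation p := (@normal_pdf R 0 1).

Import HBNNSimple.

(** On indicators both sides agree by the definition of [normal_prob] as the integral of its
    density. Simple functions follow by linearity, and the general case by monotone convergence
    along [nnsfun_approx]. *)
Lemma ge0_integral_std_normal (f : R -> \bar R) :
  measurable_fun setT f -> (forall x, 0 <= f x)%E ->
  (\int[N]_x f x = \int[lam]_x (f x * (p x)%:E))%E.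
Proof.
move=> mf f0.
pose f_ := nnsfun_approx measurableT mf.
have cvf x : (EFin \o f_^~ x) @ \oo --> f x.
  by apply: cvg_nnsfun_approx.
have ndf x m n : (m <= n)%N -> f_ m x <= f_ n x.
  by move=> mn; exact/lefP/nd_nnsfun_approx.
have mp : measurable_fun setT (fun x => (p x)%:E).
  by apply/measurable_EFinP; exact: measurable_normal_pdf.
have mfn n : measurable_fun setT (fun x => (f_ n x)%:E).
  exact/measurable_EFinP.
transitivity (limn (fun n => \int[N]_x (f_ n x)%:E)%E).
  rewrite -monotone_convergence//.
  - by apply: eq_integral => x _; apply/esym/cvg_lim => //; exact: cvf.
  - by move=> n x _; rewrite lee_fin.
  - by move=> x _ m n mn; rewrite lee_fin ndf.
transitivity (limn (fun n => \int[lam]_x ((f_ n x)%:E * (p x)%:E))%E); last first.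
  rewrite -monotone_convergence//.
  - by apply: eq_integral => x _; apply/cvg_lim => //; exact: (cvgeZr _ (cvf x)).
  - by move=> n; exact: emeasurable_funM (mfn n) mp.
  - by move=> n x _; rewrite -EFinM lee_fin mulr_ge0// normal_pdf_ge0.
  - move=> x _ m n mn.
    by rewrite -!EFinM lee_fin ler_wpM2r ?normal_pdf_ge0 ?ndf.
congr (limn _); apply/funext => n.
have mA k : measurable (f_ n @^-1` [set k]) by [].
have mi k : measurable_fun setT (fun x => (\1_(f_ n @^-1` [set k]) x * p x)%:E).
  apply/measurable_EFinP; apply: measurable_funM => //.
  exact: measurable_normal_pdf.
transitivity (\sum_(k \in range (f_ n))
    \int[N]_x (k * \1_(f_ n @^-1` [set k]) x)%:E)%E.
  rewrite -ge0_integral_fsum//.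
  - by apply: eq_integral => x _; rewrite fsumEFin// -fimfunE.
  - by move=> r; exact/measurable_EFinP/measurable_funM.
  - by move=> r x _; rewrite nnfun_muleindic_ge0.
transitivity (\sum_(k \in range (f_ n))
    \int[lam]_x (k%:E * (\1_(f_ n @^-1` [set k]) x * p x)%:E))%E; last first.
  rewrite -ge0_integral_fsum//.
  - apply: eq_integral => x _.
    rewrite [in RHS]fimfunE -fsumEFin// ge0_mule_fsuml.
      by apply: eq_fsbigr => r _; rewrite -!EFinM mulrA.
    by move=> r; exact: nnfun_muleindic_ge0.
  - by move=> r; exact: emeasurable_funM (mi r).
  - move=> r x _; rewrite -EFinM mulrA EFinM mule_ge0//.
      by rewrite nnfun_muleindic_ge0.
    by rewrite lee_fin normal_pdf_ge0.
apply: eq_fsbigr => r; rewrite inE => -[y _ <-].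
have r0 : (0 <= f_ n y)%R by [].
under eq_integral do rewrite EFinM.
rewrite !ge0_integralZl//.
- congr (_ * _)%E; rewrite integral_indic// setIT.
  transitivity (\int[lam]_(x in f_ n @^-1` [set f_ n y]) (p x)%:E)%E => [//|].
  rewrite [LHS]integral_mkcond; apply: eq_integral => x _; rewrite patchE indicE.
  by case: ifPn => _ /=; rewrite ?mul1r ?mul0r.
- exact: (mi (f_ n y)).
- by move=> x _; rewrite lee_fin mulr_ge0// normal_pdf_ge0.
- exact/measurable_EFinP.
Qed.

Let shift_meas s : measurable_fun setT (fun x : R => x + s).
Proof. exact: measurable_funD. Qed.

(** Uniqueness of Lebesgue measure: the pushforward by a translation still gives every half-open
    interval its length. *)
Lemma lebesgue_measure_shift s (A : set R) : measurable A ->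
  pushforward lam ((fun x => x + s) : _ -> measurableTypeR R) A = lam A.
Proof.
move=> mA; apply/esym.
pose sh : measurableTypeR R -> measurableTypeR R := fun x => x + s.
have msh : measurable_fun setT sh by exact: shift_meas.
pose sh' : {mfun measurableTypeR R >-> measurableTypeR R} :=
  HB.pack sh (isMeasurableFun.Build _ _ _ _ _ msh).
apply: (@lebesgue_measure_unique _ (pushforward lam sh')) => //.
move=> _ [[a b]] _ <-; rewrite /= /pushforward.
have -> : sh @^-1` `]a, b] = `]a - s, b - s]%classic.
  by apply/seteqP; split=> x /=; rewrite !in_itv/= ltrBlDr lerBrDr.
rewrite !lebesgue_measure_itv/= !lte_fin ltrD2r.
by case: ifP => // _; rewrite -!EFinD; congr EFin; ring.
Qed.

Lemma normal_pdf_shift s x :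
  p (x - s) = expR (s * x - s ^+ 2 / 2) * p x.
Proof.
rewrite normal_pdfE ?oner_eq0// /normal_fun mulrCA; congr (_ * _).
by rewrite -expRD; congr expR; rewrite !expr2 mulr1; field.
Qed.

(** The one-dimensional Cameron-Martin formula: a change of variable moves the shift from [f] to the
    density, and [normal_pdf_shift] turns it into the exponential weight. *)
Lemma ge0_integral_std_normal_shift s (f : R -> R) :
  measurable_fun setT f -> (forall x, 0 <= f x) ->
  (\int[N]_x (f (x + s))%:E =
   \int[N]_x (f x * expR (s * x - s ^+ 2 / 2))%:E)%E.
Proof.
move=> mf f0.
have me : measurable_fun setT (fun x => expR (s * x - s ^+ 2 / 2)).
  by apply: measurableT_comp => //; apply: measurable_funB => //;
    exact: measurable_funM.
rewrite !ge0_integral_std_normal//.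
- pose g (x : measurableTypeR R) := (f x * p (x - s))%:E.
  pose sh : measurableTypeR R -> measurableTypeR R := fun x => x + s.
  have msh : measurable_fun setT sh by exact: shift_meas.
  transitivity (\int[lam]_x (g \o sh) x)%E.
    by apply: eq_integral => x _; rewrite /g /= addrK EFinM.
  have mg : measurable_fun setT g.
    apply/measurable_EFinP; apply: measurable_funM => //.
    by apply: measurableT_comp; [exact: measurable_normal_pdf|exact: measurable_funB].
  rewrite -[LHS](ge0_integral_pushforward msh lam measurableT mg); last first.
    by move=> x _; rewrite lee_fin mulr_ge0// normal_pdf_ge0.
  transitivity (\int[lam]_x g x)%E.
    by apply: eq_measure_integral => A mA _; exact: lebesgue_measure_shift.
  by apply: eq_integral => x _; rewrite /g normal_pdf_shift mulrA EFinM.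
- by apply/measurable_EFinP; exact: measurable_funM.
- by move=> x; rewrite lee_fin mulr_ge0// expR_ge0.
- by apply/measurable_EFinP; exact: measurableT_comp.
- by move=> x; rewrite lee_fin.
Qed.

End gaussian.

(** An elementary passage to the limit [r -> 0], used for the Gaussian moments, for Cauchy-Schwarz
    and for the descent inequality. If [a] were positive, [r = 1] would force [K > 0], and
    [r <= a / (2 K)] would give [a <= a / 2]. *)
Lemma le0_of_le_small (R : realFieldType) (a K : R) :
  (forall r, 0 < r -> r <= 1 -> a <= r * K) -> a <= 0.
Proof.
move=> h; rewrite leNgt; apply/negP => a0.
have K0 : 0 < K by rewrite -[K]mul1r (lt_le_trans a0)// h.
have r0 : 0 < Num.min 1 (a / (2 * K)).
  by rewrite lt_min ltr01 divr_gt0// mulr_gt0.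
have := h _ r0; rewrite ge_min lexx => /(_ erefl); apply/negP; rewrite -ltNge.
apply: (@le_lt_trans _ _ (a / (2 * K) * K)).
  by rewrite ler_pM2r// ge_min lexx orbT.
rewrite (_ : a / (2 * K) * K = a / 2); last by field; rewrite gt_eqF.
lra.
Qed.

(** * Moments and Stein's identity from the tilted density *)

Section gaussian_moments.
Variable R : realType.
Implicit Types (s x c C L : R) (f g : R -> R).
Local Notation N := (@std_normal R).
Local Notation Z s := (fun x : R => expR (s * x - s ^+ 2 / 2)).

Lemma measurable_tilt s : measurable_fun setT (Z s).
Proof.
by apply: measurableT_comp => //; apply: measurable_funB => //;
  exact: measurable_funM.
Qed.

Lemma integ_tilt s : integ N (Z s).
Proof.
apply: integ_ge0; [exact: measurable_tilt|by move=> x; exact: expR_ge0|].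
have m1 : measurable_fun setT (fun _ : R => 1 : R) by [].
have := ge0_integral_std_normal_shift s m1 (fun=> ler01).
under [X in _ = X -> _]eq_integral do rewrite mul1r.
by move=> <-; rewrite integral_cst//= mul1e probability_setT ltry.
Qed.

Lemma integ_expR_normr c : integ N (fun x => expR (c * `|x|)).
Proof.
have ie t : integ N (fun x => expR (t * x)).
  have := integZ (expR (t ^+ 2 / 2)) (integ_tilt t).
  congr (integ _ _); apply/funext => x.
  by rewrite -expRD; congr expR; ring.
apply: (integ_le _ _ (integD (ie c) (ie (- c)))).
  by apply: measurableT_comp => //; exact: measurable_funM.
move=> x; rewrite ger0_norm ?expR_ge0//.
have [x0|x0] := leP 0 x.
  by rewrite ger0_norm// lerDl expR_ge0.
by rewrite ltr0_norm// mulrN -mulNr lerDr expR_ge0.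
Qed.

Lemma integ_normal_dom c C f : measurable_fun setT f ->
  (forall x, `|f x| <= C * expR (c * `|x|)) -> integ N f.
Proof. by move=> mf h; exact: (integ_le mf h (integZ C (integ_expR_normr c))). Qed.

Lemma normr_le_expR x : `|x| <= expR `|x|.
Proof. by apply: le_trans (expR_ge1Dx _); rewrite lerDr. Qed.

(** The nonnegative formula is applied to [|f|] and to [|f| + f], whose difference gives [f]. *)
Lemma normal_shift s f : measurable_fun setT f ->
  integ N (fun x => f x * Z s x) ->
  integ N (fun x => f (x + s)) /\
  \int[N]_x f (x + s) = \int[N]_x (f x * Z s x).
Proof.
move=> mf hf.
have ge0 (g : R -> R) : measurable_fun setT g -> (forall x, 0 <= g x) ->
    integ N (fun x => g x * Z s x) ->
    integ N (fun x => g (x + s)) /\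
    \int[N]_x g (x + s) = \int[N]_x (g x * Z s x).
  move=> mg g0 hg; have e := ge0_integral_std_normal_shift s mg g0.
  split; last by rewrite /Rintegral e.
  apply: integ_ge0 => //.
    by apply: measurableT_comp => //; exact: measurable_funD.
  by rewrite e; exact: (integrable_lty _ hg).
have mn : measurable_fun setT (fun x => `|f x|).
  by apply: measurableT_comp => //; exact: normr_measurable.
have hn : integ N (fun x => `|f x| * Z s x).
  have := integ_norm hf; congr (integ _ _); apply/funext => x.
  by rewrite normrM (ger0_norm (expR_ge0 _)).
have [i1 e1] : integ N (fun x => `|f (x + s)|) /\
    \int[N]_x `|f (x + s)| = \int[N]_x (`|f x| * Z s x).
  by apply: (ge0 (fun x => `|f x|)).
have [i2 e2] : integ N (fun x => `|f (x + s)| + f (x + s)) /\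
    \int[N]_x (`|f (x + s)| + f (x + s)) = \int[N]_x ((`|f x| + f x) * Z s x).
  apply: (ge0 (fun x => `|f x| + f x)).
  - exact: measurable_funD.
  - by move=> x; rewrite -lerBlDr sub0r -normrN ler_norm.
  - have := integD hn hf; congr (integ _ _); apply/funext => x.
    by rewrite mulrDl.
have i3 : integ N (fun x => f (x + s)).
  have := integB i2 i1; congr (integ _ _); apply/funext => x.
  by rewrite addrAC subrr add0r.
split=> //.
apply: (@addrI _ (\int[N]_x `|f (x + s)|)).
rewrite -ExD// e2 e1 -ExD//; apply: eq_Ex => x; by rewrite mulrDl.
Qed.

(** Everything follows from [1 + y <= expR y] at [x] and at [- x]. The latter gives
    [expR x - 1 <= x * expR x], so the remainder is at most [x * (expR x - 1)]. *)
Lemma expR_taylor2 x : `|expR x - 1 - x| <= x ^+ 2 * expR `|x|.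
Proof.
have h1 : 0 <= expR x - 1 - x by have := expR_ge1Dx x; lra.
rewrite ger0_norm//.
have h2 : expR x - 1 <= x * expR x.
  have := expR_ge1Dx (- x); rewrite expRN => h.
  have := expR_gt0 x => e0.
  have : (1 - x) * expR x <= 1.
    by rewrite -[leRHS](mulVf (lt0r_neq0 e0)) ler_pM2r.
  nra.
have [x0|x0] := leP 0 x.
  rewrite (ger0_norm x0); nra.
have e1 : 1 <= expR `|x| by rewrite -expR0 ler_expR.
have := expR_ge1Dx x; nra.
Qed.

(** For the exponent [y], [|s| <= 1] gives [|y| <= |s| * (1 + |x|) <= |s| * expR |x|], so the
    remainder of [expR_taylor2] is at most [s ^+ 2 * expR 1 * expR (3 * |x|)]. The term [s ^+ 2 / 2]
    inside [y] accounts for the factor 2. *)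
Lemma tilt_taylor s x : `|s| <= 1 ->
  `|Z s x - 1 - s * x| <= s ^+ 2 * (2 * expR 1 * expR (3 * `|x|)).
Proof.
move=> s1; set y := s * x - s ^+ 2 / 2.
have s2 : s ^+ 2 = `|s| ^+ 2 by rewrite real_normK ?num_real.
have ny : `|y| <= `|s| * (1 + `|x|).
  apply: (le_trans (ler_normB _ _)).
  rewrite normrM (ger0_norm (_ : 0 <= s ^+ 2 / 2)); last first.
    by rewrite divr_ge0 ?sqr_ge0.
  rewrite s2; have := normr_ge0 s; nra.
have b1 : 1 + `|x| <= expR `|x| by exact: expR_ge1Dx.
have y2 : y ^+ 2 <= s ^+ 2 * expR `|x| ^+ 2.
  rewrite -(real_normK (num_real y)) s2 -exprMn lerXn2r ?nnegrE ?mulr_ge0 ?expR_ge0//.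
  by apply: (le_trans ny); rewrite ler_wpM2l.
have ey : expR `|y| <= expR 1 * expR `|x|.
  rewrite -expRD ler_expR (le_trans ny)// ler_piMl// addr_ge0//.
have := expR_taylor2 y => ty.
have -> : expR y - 1 - s * x = (expR y - 1 - y) - s ^+ 2 / 2.
  by rewrite /y; lra.
apply: (le_trans (ler_normB _ _)).
rewrite (ger0_norm (_ : 0 <= s ^+ 2 / 2)); last by rewrite divr_ge0 ?sqr_ge0.
have e3 : expR (3 * `|x|) = expR `|x| ^+ 2 * expR `|x|.
  by rewrite -exprSr -expRM_natl.
have x1 : 1 <= expR `|x| by rewrite -expR0 ler_expR.
have one1 : 1 <= expR 1 :> R by rewrite -expR0 ler_expR.
have t1 : y ^+ 2 * expR `|y| <= s ^+ 2 * (expR 1 * expR (3 * `|x|)).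
  rewrite e3 (_ : s ^+ 2 * _ = (s ^+ 2 * expR `|x| ^+ 2) * (expR 1 * expR `|x|));
    last by ring.
  by apply: ler_pM => //; rewrite ?sqr_ge0 ?expR_ge0.
have t2 : s ^+ 2 / 2 <= s ^+ 2 * (expR 1 * expR (3 * `|x|)).
  apply: ler_wpM2l; first exact: sqr_ge0.
  have : 1 <= expR (3 * `|x|) by rewrite -expR0 ler_expR mulr_ge0.
  nra.
by have := le_trans ty t1; lra.
Qed.

(** The exponent 4 is the 3 of [tilt_taylor] plus the 1 allowed for the growth of the test function
    in [normal_tilt_bound]. *)
Definition tilt_const : R := 2 * expR 1 * \int[N]_x expR (4 * `|x|).
Local Notation K := tilt_const.

Lemma tilt_const_ge0 : 0 <= K.
Proof.
rewrite mulr_ge0 ?mulr_ge0 ?expR_ge0//; apply: Rintegral_ge0 => x _.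
exact: expR_ge0.
Qed.

Lemma integ_normal_poly n f C : measurable_fun setT f ->
  (forall x, `|f x| <= C * `|x| ^+ n) -> integ N f.
Proof.
move=> mf h; have C0 : 0 <= C.
  by have := h 1; rewrite normr1 expr1n mulr1; exact: le_trans.
apply: (@integ_normal_dom n%:R C) => // x; apply: (le_trans (h x)).
apply: ler_wpM2l => //.
by rewrite expRM_natl; apply: lerXn2r; rewrite ?nnegrE ?expR_ge0// normr_le_expR.
Qed.

(** The Taylor expansion of the tilt in [s], multiplied by [f] and integrated. Exponential growth is
    allowed so that constants, the identity and Lipschitz functions vanishing at 0 are all
    covered. *)
Lemma normal_tilt_bound L s f : 0 <= L -> `|s| <= 1 -> measurable_fun setT f ->
  (forall x, `|f x| <= L * expR `|x|) ->
  [/\ integ N (fun x => f (x + s)), integ N f, integ N (fun x => s * (x * f x))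
   & `|\int[N]_x f (x + s) - \int[N]_x f x - \int[N]_x (s * (x * f x))|
      <= L * s ^+ 2 * K].
Proof.
move=> L0 s1 mf hf.
have mxf : measurable_fun setT (fun x => x * f x) by exact: measurable_funM.
have hxf : integ N (fun x => x * f x).
  apply: (@integ_normal_dom 2 L) => // x; rewrite normrM mulrC.
  rewrite (_ : 2 * `|x| = `|x| + `|x|); last by ring.
  by rewrite expRD mulrA; apply: ler_pM => //; exact: normr_le_expR.
have hf0 : integ N f.
  by apply: (@integ_normal_dom 1 L) => // x; rewrite mul1r.
have dom x : `|f x * (Z s x - 1 - s * x)| <=
    (L * s ^+ 2 * (2 * expR 1)) * expR (4 * `|x|).
  rewrite normrM; have := tilt_taylor x s1 => t.
  have := ler_pM (normr_ge0 _) (normr_ge0 _) (hf x) t.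
  rewrite (_ : 4 * `|x| = `|x| + 3 * `|x|); last by ring.
  by rewrite [expR (`|x| + _)]expRD => /le_trans; apply; rewrite le_eqVlt; apply/orP;
    left; apply/eqP; ring.
have md : measurable_fun setT (fun x => f x * (Z s x - 1 - s * x)).
  apply: measurable_funM => //; apply: measurable_funB; last exact: measurable_funM.
  by apply: measurable_funB => //; exact: measurable_tilt.
have hd : integ N (fun x => f x * (Z s x - 1 - s * x)).
  exact: (integ_normal_dom md dom).
have hfZ : integ N (fun x => f x * Z s x).
  have := integD hd (integD hf0 (integZ s hxf)).
  by congr (integ _ _); apply/funext => x; ring.
have [h1 e1] := normal_shift mf hfZ.
split=> //; first exact: integZ.
rewrite e1 -ExB// -ExB//; last 2 first.
- exact: integB.
- exact: integZ.
rewrite (_ : (fun x => _) = (fun x => f x * (Z s x - 1 - s * x))); last first.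
  by apply/funext => x; ring.
apply: (le_trans (le_normr_Rintegral _ hd)) => //.
rewrite /K (_ : L * s ^+ 2 * _ = L * s ^+ 2 * (2 * expR 1) * \int[N]_x expR (4 *
  `|x|)); last by ring.
rewrite -ExZ; last exact: integ_expR_normr.
apply: Ex_le => //; first exact: integ_norm.
exact: integZ (integ_expR_normr _).
Qed.

Lemma integ_normal_id : integ N (fun x => x).
Proof. by apply: (@integ_normal_poly 1 _ 1) => // x; rewrite mul1r. Qed.

(** For [f = 1] the shift changes nothing, so [normal_tilt_bound] says that [s] times the mean is
    [O(s^2)]; dividing by [s] and letting it tend to 0 gives 0. The second moment below comes in the
    same way from [f x = x], to which the shift adds [s]. *)
Lemma normal_mean : \int[N]_x x = 0.
Proof.
have h s : 0 < s -> s <= 1 -> `|\int[N]_x x| <= s * K.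
  move=> s0 s1; have [] := @normal_tilt_bound 1 s (fun=> 1) ler01.
  - by rewrite ger0_norm// ltW.
  - exact: measurable_cst.
  - by move=> x; rewrite normr1 mul1r -expR0 ler_expR.
  - move=> _ _ _; rewrite subrr sub0r normrN.
    under eq_Rintegral do rewrite mulr1.
    rewrite ExZ; last exact: integ_normal_id.
    by rewrite normrM (gtr0_norm s0) mul1r expr2 -mulrA ler_pM2l.
by apply/eqP; rewrite -normr_eq0 eq_le normr_ge0 andbT (le0_of_le_small h).
Qed.

Lemma integ_normal_sqr : integ N (fun x => x ^+ 2).
Proof.
by apply: (@integ_normal_poly 2 _ 1); [exact: measurable_funX|move=> x;
  rewrite mul1r normrX].
Qed.

Lemma normal_sqr : \int[N]_x (x ^+ 2) = 1.
Proof.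
have h s : 0 < s -> s <= 1 -> `|1 - \int[N]_x (x ^+ 2)| <= s * K.
  move=> s0 s1; have [] := @normal_tilt_bound 1 s (fun x => x) ler01.
  - by rewrite ger0_norm// ltW.
  - exact: measurable_id.
  - by move=> x; rewrite mul1r normr_le_expR.
  - move=> _ _ _.
    rewrite ExD; [|exact: integ_normal_id|exact: integ_cst].
    rewrite normal_mean Ex_cst add0r subr0.
    under [X in _ - X]eq_Rintegral do rewrite -expr2.
    rewrite ExZ; last exact: integ_normal_sqr.
    rewrite -{1}[s]mulr1 -mulrBr.
    by rewrite normrM (gtr0_norm s0) mul1r expr2 -mulrA ler_pM2l.
apply/eqP; rewrite eq_sym -subr_eq0 -normr_eq0 eq_le normr_ge0 andbT.
exact: (le0_of_le_small h).
Qed.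

Lemma integ_normal_four : integ N (fun x => x ^+ 4).
Proof.
by apply: (@integ_normal_poly 4 _ 1); [exact: measurable_funX|move=> x;
  rewrite mul1r normrX].
Qed.

(** For [|s| <= 1] this is the tilt expansion. For larger [s], which occur because the shift will be
    random, the Lipschitz property bounds the integrand by [L * s ^+ 2 * (1 + x ^+ 2)], using
    [|s| <= s ^+ 2]; the mean of [1 + x ^+ 2] is the 2 in the constant. Replacing [f] by [f - f 0]
    is harmless since the mean of the normal law is 0. *)
Lemma normal_stein L s f : 0 <= L -> measurable_fun setT f ->
  (forall x y, `|f x - f y| <= L * `|x - y|) ->
  integ N (fun x => f (x + s) - f x - s * (x * f x)) /\
  \int[N]_x (f (x + s) - f x - s * (x * f x)) <= (K + 2) * L * s ^+ 2.
Proof.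
move=> L0 mf lf.
pose g x := f x - f 0.
have mg : measurable_fun setT g by exact: measurable_funB.
have gL x : `|g x| <= L * `|x| by have := lf x 0; rewrite subr0.
have K0 := tilt_const_ge0.
have Ls0 : 0 <= L * s ^+ 2 by rewrite mulr_ge0 ?sqr_ge0.
have hg : integ N (fun x => g (x + s) - g x - s * (x * g x)) /\
  \int[N]_x (g (x + s) - g x - s * (x * g x)) <= (K + 2) * L * s ^+ 2.
  have [s1|s1] := leP `|s| 1.
    have [|i1 i2 i3 b] := normal_tilt_bound L0 s1 mg.
      by move=> x; apply: (le_trans (gL x)); rewrite ler_wpM2l// normr_le_expR.
    split; first by apply: integB => //; exact: integB.
    rewrite ExB//; last exact: integB.
    rewrite ExB//; apply: (le_trans (ler_norm _)); apply: (le_trans b).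
    nra.
  have dom x : `|g (x + s) - g x - s * (x * g x)| <= L * s ^+ 2 * (1 + x ^+ 2).
    apply: (le_trans (ler_normB _ _)).
    have e1 : `|g (x + s) - g x| <= L * `|s|.
      have -> : g (x + s) - g x = f (x + s) - f x by rewrite /g; ring.
      by have := lf (x + s) x; rewrite addrAC subrr add0r.
    have e2 : `|s * (x * g x)| <= L * `|s| * x ^+ 2.
      rewrite !normrM -(real_normK (num_real x)).
      have := ler_wpM2l (mulr_ge0 (normr_ge0 s) (normr_ge0 x)) (gL x).
      by rewrite -mulrA => /le_trans; apply; rewrite le_eqVlt; apply/orP; left;
        apply/eqP; ring.
    have s2 : `|s| <= s ^+ 2.
      by rewrite -(real_normK (num_real s)) expr2 ler_peMl// ltW.
    have := sqr_ge0 x; have := ler_wpM2l L0 s2; nra.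
  have md : measurable_fun setT (fun x => g (x + s) - g x - s * (x * g x)).
    apply: measurable_funB; last first.
      by apply: measurable_funM => //; exact: measurable_funM.
    apply: measurable_funB => //; apply: measurableT_comp => //.
    exact: measurable_funD.
  have id : integ N (fun x => L * s ^+ 2 * (1 + x ^+ 2)).
    by apply: integZ; apply: integD; [exact: integ_cst|exact: integ_normal_sqr].
  have ig := integ_le md dom id.
  split=> //; apply: (@le_trans _ _ (\int[N]_x (L * s ^+ 2 * (1 + x ^+ 2)))).
    by apply: Ex_le => // x; apply: (le_trans (ler_norm _)).
  rewrite ExZ; last by apply: integD; [exact: integ_cst|exact: integ_normal_sqr].
  rewrite ExD; [|exact: integ_cst|exact: integ_normal_sqr].
  rewrite Ex_cst normal_sqr; nra.
have [ig bg] := hg.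
have e x : f (x + s) - f x - s * (x * f x) =
    (g (x + s) - g x - s * (x * g x)) - s * f 0 * x.
  by rewrite /g; ring.
have -> : (fun x => f (x + s) - f x - s * (x * f x)) =
    (fun x => (g (x + s) - g x - s * (x * g x)) - s * f 0 * x).
  exact/funext.
have ix : integ N (fun x => s * f 0 * x) by apply: integZ; exact: integ_normal_id.
split; first exact: integB.
rewrite ExB// ExZ; last exact: integ_normal_id.
by rewrite normal_mean mulr0 subr0.
Qed.

End gaussian_moments.

(** * Independence *)

Section independence_fubini.
Context dO (Omega : measurableType dO) dS (S : measurableType dS)
  (R : realType) (P : probability Omega R) (mu : probability S R).
Variables (Z : Omega -> S) (G : set (set Omega)).
Hypothesis mZ : measurable_fun setT Z.
Hypothesis mG : G `<=` measurable.
Hypothesis indep : forall A B, measurable A -> <<s G >> B ->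
  P (Z @^-1` A `&` B) = (mu A * P B)%E.

(** [Omega] with the smaller sigma-algebra generated by [G]: measurability on [OG] expresses that a
    function does not look at the independent component [Z]. *)
Local Notation OG := (g_sigma_algebraType G).

Lemma sub_sigma_measurable : <<s G >> `<=` (@measurable _ Omega).
Proof. exact: (smallest_sub (@sigma_algebra_measurable _ Omega) mG). Qed.

Lemma measurable_forget d' (T' : measurableType d') (f : Omega -> T') :
  measurable_fun (setT : set OG) f -> measurable_fun setT f.
Proof.
by move=> mf _ A mA; apply: sub_sigma_measurable; exact: (mf measurableT A mA).
Qed.

Let idG : Omega -> OG := id.
Let midG : measurable_fun setT idG.
Proof. by move=> _ A mA; rewrite setTI; exact: sub_sigma_measurable. Qed.
Let XG : {mfun Omega >-> OG} :=
  HB.pack idG (isMeasurableFun.Build _ _ _ _ _ midG).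
Let PG := distribution P XG.

Let h : Omega -> S * OG := fun w => (Z w, idG w).
Let mh : measurable_fun setT h.
Proof. exact: measurable_fun_pair. Qed.
Let H : {mfun Omega >-> (S * OG)%type} :=
  HB.pack h (isMeasurableFun.Build _ _ _ _ _ mh).

(** [indep] is the product formula on rectangles, and it determines the law of the pair. *)
Let PH_prod A : measurable A -> distribution P H A = (mu \x PG)%E A.
Proof.
move=> mA; apply/esym; exact: product_measure_unique.
Qed.

Lemma measurable_graph (D : S * OG -> \bar R) : measurable_fun setT D ->
  measurable_fun setT (fun w => D (Z w, w)).
Proof. by move=> mD; exact: (measurableT_comp mD mh). Qed.

Lemma measurable_inner (D : S * OG -> \bar R) : measurable_fun setT D ->
  (forall z, 0 <= D z)%E ->
  measurable_fun setT (fun w : Omega => \int[mu]_s D (s, w))%E.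
Proof.
by move=> mD D0; apply: measurable_forget; exact: measurable_fun_fubini_tonelli_G.
Qed.

(** This takes the place of conditional expectation given [<<s G>>]: [w] is frozen while [Z w] is
    replaced by a variable of law [mu]. *)
Lemma indep_ge0_integral (D : S * OG -> \bar R) : measurable_fun setT D ->
  (forall z, 0 <= D z)%E ->
  (\int[P]_w D (Z w, w) = \int[P]_w \int[mu]_s D (s, w))%E.
Proof.
move=> mD D0.
transitivity (\int[distribution P H]_z D z)%E.
  by rewrite ge0_integral_pushforward.
transitivity (\int[mu \x PG]_z D z)%E.
  by apply: eq_measure_integral => A mA _; exact: PH_prod.
rewrite fubini_tonelli2//.
rewrite ge0_integral_pushforward//.
  exact: measurable_fun_fubini_tonelli_G.
by move=> w _; apply: integral_ge0.
Qed.

Lemma indep_integral (D : S * OG -> \bar R) : measurable_fun setT D ->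
  P.-integrable setT (fun w => D (Z w, w)) ->
  P.-integrable setT (fun w : Omega => \int[mu]_s D (s, w))%E /\
  (\int[P]_w D (Z w, w) = \int[P]_w \int[mu]_s D (s, w))%E.
Proof.
move=> mD iD.
have iH : (distribution P H).-integrable setT D.
  exact: integrable_pushforward.
have iP : (mu \x PG)%E.-integrable setT D.
  move/integrableP : iH => [_ i]; apply/integrableP; split => //.
  apply: le_lt_trans i; rewrite le_eqVlt; apply/orP; left; apply/eqP.
  by apply: eq_measure_integral => A mA _; exact/esym/PH_prod.
have mGf := measurable_fubini_G iP.
have iG : PG.-integrable setT (fun w : OG => \int[mu]_s D (s, w))%E.
  apply/integrableP; split => //.
  move/(integrable21ltyP mu PG mD): iP; apply: le_lt_trans.
  apply: ge0_le_integral => //.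
  - exact: measurableT_comp.
  - apply: (@measurable_fun_fubini_tonelli_G _ _ S OG _ mu (abse \o D)).
      exact: measurableT_comp.
    by move=> z; exact: abse_ge0.
  - by move=> w _; apply: le_abse_integral => //; exact: measurableT_comp.
split.
  move/integrableP : iG => [_ i]; apply/integrableP; split.
    exact: measurable_forget.
  apply: le_lt_trans i; rewrite ge0_integral_pushforward//.
  exact: measurableT_comp.
transitivity (\int[distribution P H]_z D z)%E.
  by rewrite integral_pushforward.
transitivity (\int[mu \x PG]_z D z)%E.
  by apply: eq_measure_integral => A mA _; exact: PH_prod.
rewrite -integral21_prod_meas1//.
rewrite integral_pushforward//.
move/integrableP : iG => [_ i]; apply/integrableP; split.
  exact: measurable_forget.
apply: le_lt_trans i; rewrite ge0_integral_pushforward//.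
exact: measurableT_comp.
Qed.

(** For nonnegative integrands a bound on the inner integral yields integrability as well; the
    signed version [indep_le] takes integrability as a hypothesis. *)
Lemma indep_ge0_le (D : S -> Omega -> R) (B : Omega -> R) :
  measurable_fun setT (fun z : S * OG => D z.1 z.2) ->
  (forall s w, 0 <= D s w) ->
  (forall w, \int[mu]_s (D s w)%:E <= (B w)%:E)%E -> integ P B ->
  integ P (fun w => D (Z w) w) /\ \int[P]_w D (Z w) w <= \int[P]_w B w.
Proof.
move=> mD D0 DB iB.
have mDE : measurable_fun setT (fun z : S * OG => (D z.1 z.2)%:E).
  exact/measurable_EFinP.
have e := indep_ge0_integral mDE (fun z => D0 z.1 z.2).
have le : (\int[P]_w (D (Z w) w)%:E <= \int[P]_w (B w)%:E)%E.
  rewrite e; apply: ge0_le_integral => //.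
  - by move=> w _; apply: integral_ge0 => s _; rewrite lee_fin.
  - by apply: (measurable_inner mDE) => z; rewrite lee_fin.
  - exact: (measurable_int _ iB).
  - by move=> w _; exact: DB.
have iD : integ P (fun w => D (Z w) w).
  apply: integ_ge0 => //.
  - by apply/measurable_EFinP; exact: (measurable_graph mDE).
  - exact: (le_lt_trans le (integrable_lty measurableT iB)).
by split=> //; rewrite -lee_fin !Ex_EFin.
Qed.

Lemma indep_le (D : S -> Omega -> R) (B : Omega -> R) :
  measurable_fun setT (fun z : S * OG => D z.1 z.2) ->
  integ P (fun w => D (Z w) w) ->
  (forall w, integ mu (D ^~ w)) ->
  (forall w, \int[mu]_s D s w <= B w) -> integ P B ->
  \int[P]_w D (Z w) w <= \int[P]_w B w.
Proof.
move=> mD iD iDw DB iB.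
have mDE : measurable_fun setT (fun z : S * OG => (D z.1 z.2)%:E).
  exact/measurable_EFinP.
have [i e] := indep_integral mDE iD.
rewrite -lee_fin !Ex_EFin// e; apply: le_integral => // w _.
by rewrite /= -Ex_EFin// lee_fin.
Qed.

(** Integrability comes from the nonnegative bound applied to absolute values. The equality comes
    from [indep_le] applied to the product and to its opposite. *)
Lemma indepM (f : S -> R) (W : Omega -> R) :
  integ mu f -> measurable_fun (setT : set OG) W -> integ P W ->
  integ P (fun w => f (Z w) * W w) /\
  \int[P]_w (f (Z w) * W w) = \int[mu]_s f s * \int[P]_w W w.
Proof.
move=> hf mW iW; have mf := integ_meas hf.
have mD : measurable_fun setT (fun z : S * OG => f z.1 * W z.2).
  by apply: measurable_funM; exact: measurableT_comp.
have mDn : measurable_fun setT (fun z : S * OG => `|f z.1| * `|W z.2|).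
  by apply: measurable_funM; apply: measurableT_comp => //; exact: measurableT_comp.
have ia : integ P (fun w => `|f (Z w)| * `|W w|).
  apply: (indep_ge0_le (D := fun s w => `|f s| * `|W w|)
    (B := fun w => \int[mu]_s `|f s| * `|W w|) mDn _ _ _).1 => //.
  - move=> w; rewrite -Ex_EFin.
      rewrite lee_fin mulrC -ExZ; last exact: integ_norm.
      by rewrite (_ : (fun x => _) = (fun s => `|W w| * `|f s|))//;
        apply/funext => s; rewrite mulrC.
    rewrite /integ (_ : EFin \o _ = EFin \o (fun s => `|W w| * `|f s|)).
      exact/integZ/integ_norm.
    by apply/funext => s; rewrite /= mulrC.
  - exact/integZ/integ_norm.
have iM : integ P (fun w => f (Z w) * W w).
  apply: (integ_le _ _ ia); last by move=> w; rewrite normrM.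
  apply: measurable_funM; first exact: measurableT_comp.
  exact: measurable_forget.
have iDw c w : integ mu (fun s => c * (f s * W w)).
  rewrite (_ : (fun s => _) = (fun s => (c * W w) * f s)); last by apply/funext => s;
    ring.
  exact: integZ.
have eDw c w : \int[mu]_s (c * (f s * W w)) = c * (\int[mu]_s f s * W w).
  rewrite (_ : (fun s => _) = (fun s => (c * W w) * f s)); last by apply/funext => s;
    ring.
  by rewrite ExZ//; ring.
split=> //; apply/eqP; rewrite eq_le; apply/andP; split.
  rewrite -ExZ//.
  apply: (indep_le (D := fun s w => f s * W w)) => //.
  - by move=> w; have := iDw 1 w; under eq_fun do rewrite mul1r.
  - by move=> w; have := eDw 1 w; under eq_Rintegral do rewrite mul1r; move=> ->;
    rewrite mul1r.
  - exact: integZ.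
have : \int[P]_w (-1 * (f (Z w) * W w)) <= \int[P]_w (-1 * (\int[mu]_s f s * W w)).
  apply: (indep_le (D := fun s w => -1 * (f s * W w))) => //.
  - exact: measurable_funM.
  - exact: integZ.
  - by move=> w; rewrite eDw.
  - by do 2 apply: integZ.
rewrite !ExZ//; first lra.
exact: integZ.
Qed.

End independence_fubini.

Lemma mem_bigsetI (I : choiceType) (T : Type) (s : seq I) (A : I -> set T) w :
  (\big[setI/setT]_(i <- s) A i) w <-> forall i, i \in s -> A i w.
Proof. by rewrite -bigcap_seq; split=> h i; exact: h. Qed.

(** * Independence of one component from all the others *)

Section product_rule.
Context dO (Omega : measurableType dO) (R : realType) (P : probability Omega R).
Variables (J : finType) (E : nat -> J -> set (set Omega)).
Hypothesis ET : forall t j, E t j setT.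
Hypothesis EI : forall t j, setI_closed (E t j).
Hypothesis Em : forall t j, E t j `<=` measurable.
Hypothesis prodE : forall N (A : nat -> J -> set Omega),
  (forall t j, E t j (A t j)) ->
  (P [set w | forall t j, (t < N)%N -> A t j w] =
   \prod_(t < N) \prod_(j : J) P (A t j))%E.

(** Each event concerns a single component different from [(t0, j0)]; together they generate the
    sigma-algebra of all the remaining noise, past, simultaneous and future. *)
Definition others (t0 : nat) (j0 : J) : set (set Omega) :=
  [set X | exists t j, (t, j) != (t0, j0) /\ E t j X].

Let cyl (t0 : nat) (j0 : J) : set (set Omega) := [set C |
  exists N A, [/\ forall t j, E t j (A t j),
    forall t j, (N <= t)%N -> A t j = setT, A t0 j0 = setT
    & C = [set w | forall t j, A t j w]]].

Let cylT t0 j0 : cyl t0 j0 setT.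
Proof.
exists 0%N, (fun _ _ => setT); split=> //.
by apply/seteqP; split.
Qed.

Let cyl_others t0 j0 : others t0 j0 `<=` cyl t0 j0.
Proof.
move=> X [t [j [ne EX]]].
exists t.+1, (fun t' j' => if (t', j') == (t, j) then X else setT); split.
- by move=> t' j'; case: eqP => [[-> ->]|].
- move=> t' j' tt'; case: eqP => // -[e _].
  by rewrite e ltnn in tt'.
- by rewrite eq_sym (negbTE ne).
- apply/seteqP; split=> [w Xw t' j'|w /(_ t j)]; first by case: ifP.
  by rewrite eqxx.
Qed.

Let cylI t0 j0 : setI_closed (cyl t0 j0).
Proof.
move=> _ _ [N1 [A1 [E1 T1 O1 ->]]] [N2 [A2 [E2 T2 O2 ->]]].
exists (maxn N1 N2), (fun t j => A1 t j `&` A2 t j); split.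
- by move=> t j; exact: EI.
- by move=> t j; rewrite geq_max => /andP[h1 h2]; rewrite T1// T2// setIT.
- by rewrite O1 O2 setIT.
- apply/seteqP; split=> [w [h1 h2] t j|w h]; first by split.
  by split=> t j; have [] := h t j.
Qed.

Let cylm t0 j0 : cyl t0 j0 `<=` measurable.
Proof.
move=> _ [N [A [EA _ _ ->]]].
rewrite (_ : [set w | _] = \bigcap_t \big[setI/setT]_(j <- enum J) A t j).
  apply: bigcapT_measurable => t; apply: bigsetI_measurable => j _.
  exact: Em (EA t j).
apply/seteqP; split=> [w h t _|w h t j].
  by apply/mem_bigsetI => j _; exact: h.
by have /mem_bigsetI := h t I; apply; rewrite mem_enum.
Qed.

(** [C] leaves the slot [(t0, j0)] free, so placing [A] there gives another finite cylinder, and the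
    two product formulas differ exactly by the factor [P A]. *)
Let cyl_indep t0 j0 A C : E t0 j0 A -> cyl t0 j0 C ->
  P (A `&` C) = (P A * P C)%E.
Proof.
move=> EA [N [B [EB BT B0 ->]]].
(* The time window must contain [t0], or the slot of [A] would be missing from the product. *)
pose M := maxn N t0.+1.
have t0M : (t0 < M)%N by rewrite leq_max leqnn orbT.
pose B' t j := if (t, j) == (t0, j0) then A else B t j.
have EB' t j : E t j (B' t j) by rewrite /B'; case: eqP => // -[-> ->].
have cut : [set w | forall t j, B t j w] =
    [set w | forall t j, (t < M)%N -> B t j w].
  apply/seteqP; split=> w h t j; first by move=> _.
  have [tM|Mt] := ltnP t M; first exact: h.
  by rewrite BT// (leq_trans _ Mt)// leq_maxl.
have cut' : A `&` [set w | forall t j, B t j w] =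
    [set w | forall t j, (t < M)%N -> B' t j w].
  rewrite cut; apply/seteqP; split=> [w [Aw h] t j tM|w h].
    by rewrite /B'; case: ifP => // _; exact: h.
  split; first by have := h t0 j0 t0M; rewrite /B' eqxx.
  move=> t j tM; have := h t j tM; rewrite /B'; case: eqP => // -[-> ->] _.
  by rewrite B0.
rewrite cut' cut !prodE//.
rewrite !pair_big/= (bigD1 (Ordinal t0M, j0))//= [in RHS](bigD1 (Ordinal t0M, j0))//=.
rewrite B0 probability_setT mul1e /B' eqxx; congr (_ * _)%E.
apply: eq_bigr => -[t j] /= ne; case: eqP => // -[e1 e2].
by move: ne; rewrite xpair_eqE -val_eqE /= e1 e2 !eqxx.
Qed.

Lemma others_measurable t0 j0 : others t0 j0 `<=` measurable.
Proof. by move=> X [t [j [_ /Em]]]. Qed.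

(* The finite cylinders with no constraint at [(t0, j0)] form a pi-system that
   generates [<<s others t0 j0 >>]. *)
Lemma others_indep t0 j0 A B : E t0 j0 A -> <<s others t0 j0 >> B ->
  P (A `&` B) = (P A * P B)%E.
Proof.
move=> EA /(sub_sigma_algebra2 (@cyl_others t0 j0)) sB.
have mA := Em EA.
have fA : P A \is a fin_num by exact: fin_num_measure.
have pA0 : 0 <= fine (P A) by apply: fine_ge0.
pose m1 : {measure set Omega -> \bar R} := mrestr P mA.
pose m2 : {measure set Omega -> \bar R} := mscale (NngNum pA0) P.
have cov : \bigcup_(k : nat) [set: Omega] = setT.
  by apply/seteqP; split=> // w _; exists 0%N.
have e12 C : cyl t0 j0 C -> m1 C = m2 C.
  move=> cC; rewrite /m1 /m2 /= /mrestr /mscale /= fineK// setIC.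
  exact: (cyl_indep EA cC).
have m1oo : (m1 setT < +oo)%E by rewrite /m1 /= /mrestr setTI -ge0_fin_numE.
have := @g_sigma_algebra_measure_unique _ _ _ (cyl t0 j0) (@cylm t0 j0)
  (fun=> setT) (fun=> cylT t0 j0) cov m1 m2 (@cylI t0 j0) e12 (fun=> m1oo) B sB.
by rewrite /m1 /m2 /= /mrestr /mscale /= fineK// setIC.
Qed.

End product_rule.

(** * Gaussian coordinates and data samples as independent components *)

Section noise.
Context dO dX (Omega : measurableType dO) (Xi : measurableType dX)
  (R : realType) (P : probability Omega R) (Q : probability Xi R) (d : nat)
  (u : nat -> Omega -> 'rV[R]_d) (xi : nat -> Omega -> Xi).
Hypothesis noise : sampling_noise P Q u xi.

(* Index [inl i] is the [i]-th coordinate of [u t], index [inr tt] is [xi t]. *)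
Definition noise_events (t : nat) (j : 'I_d + unit) : set (set Omega) :=
  match j with
  | inl i => preimage_set_system setT (fun w => u t w 0 i) measurable
  | inr _ => preimage_set_system setT (xi t) measurable
  end.

Lemma noise_measurable_u t i : measurable_fun setT (fun w => u t w 0 i).
Proof. by have [] := sn_gaussian noise t. Qed.

Lemma noise_eventsT t j : noise_events t j setT.
Proof. by case: j => [i|?]; exists setT => //; rewrite setTI. Qed.

Lemma noise_eventsI t j : setI_closed (noise_events t j).
Proof.
by case: j => [i|?] _ _ [A mA <-] [B mB <-]; exists (A `&` B);
  rewrite ?setTI ?preimage_setI//; exact: measurableI.
Qed.

Lemma noise_events_measurable t j : noise_events t j `<=` measurable.
Proof.
case: j => [i|?] _ [A mA <-].
  exact: noise_measurable_u.
exact: (sn_measurable noise t).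
Qed.

(** Independence is given at two levels, and both are used: [sn_independent] separates whole vectors
    and samples, then [std_gaussian_vector] separates the coordinates of one vector. *)
Lemma noise_events_product N (A : nat -> 'I_d + unit -> set Omega) :
  (forall t j, noise_events t j (A t j)) ->
  (P [set w | forall t j, (t < N)%N -> A t j w] =
   \prod_(t < N) \prod_(j : 'I_d + unit) P (A t j))%E.
Proof.
move=> EA.
pose B (k : nat + nat) : set Omega :=
  match k with
  | inl t => \big[setI/setT]_(i <- index_enum 'I_d) A t (inl i)
  | inr t => A t (inr tt)
  end.
pose s := [seq inl t | t <- iota 0 N] ++ [seq inr t | t <- iota 0 N] : seq (nat +
  nat).
have -> : [set w | forall t j, (t < N)%N -> A t j w] = \big[setI/setT]_(k <- s) B k.
  apply/seteqP; split=> w.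
    move=> h; apply/mem_bigsetI => k; rewrite mem_cat => /orP[|] /mapP[t];
      rewrite mem_iota add0n => /= tN -> /=; last exact: h.
    by apply/mem_bigsetI => i _; exact: h.
  move=> /mem_bigsetI h t [i|[]] tN.
    have /mem_bigsetI : B (inl t) w.
      by apply: h; rewrite mem_cat map_f// mem_iota add0n.
    by apply; rewrite mem_index_enum.
  by apply: (h (inr t)); rewrite mem_cat map_f ?orbT// mem_iota add0n.
rewrite (sn_independent noise).
- rewrite big_cat !big_map /= -big_split /= -{1}(subn0 N) -/(index_iota 0 N)
  big_mkord.
  apply: eq_bigr => t _; rewrite big_sumType /=; congr (_ * _)%E.
    have [_ ind _] := sn_gaussian noise t.
    by rewrite ind// ?index_enum_uniq// => i _; exact: (EA t (inl i)).
  by rewrite (bigD1 tt)//= big1 ?mule1// => -[].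
- rewrite cat_uniq !map_inj_uniq ?iota_uniq; [|by move=> ? ? []..].
  by rewrite andbT; apply/hasPn => k /mapP[t _ ->]; apply/mapP => -[? _].
- move=> k _; case: k => t /=; last exact: (EA t (inr tt)).
  (* An intersection of coordinate events belongs to the sigma-algebra of the whole vector, as
     [sn_independent] requires. *)
  apply: (@bigsetI_measurable _ (g_sigma_algebraType _)) => i _.
  apply: sub_sigma_algebra; rewrite -bigcup_seq; exists i.
    by rewrite /= mem_index_enum.
  exact: (EA t (inl i)).
Qed.

Definition noise_others t0 j0 := others noise_events t0 j0.

Lemma noise_others_measurable t0 j0 : noise_others t0 j0 `<=` measurable.
Proof. by apply: others_measurable; exact: noise_events_measurable. Qed.

Lemma noise_u_indep t i A B : measurable A -> <<s noise_others t (inl i) >> B ->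
  P ((fun w => u t w 0 i) @^-1` A `&` B) = (std_normal A * P B)%E.
Proof.
move=> mA sB; rewrite (others_indep noise_eventsT noise_eventsI
  noise_events_measurable noise_events_product (t0 := t) (j0 := inl i))//.
  by have [_ _ ->] := sn_gaussian noise t.
by exists A => //; rewrite setTI.
Qed.

Lemma noise_xi_indep t A B : measurable A -> <<s noise_others t (inr tt) >> B ->
  P (xi t @^-1` A `&` B) = (Q A * P B)%E.
Proof.
move=> mA sB; rewrite (others_indep noise_eventsT noise_eventsI
  noise_events_measurable noise_events_product (t0 := t) (j0 := inr tt))//.
  by rewrite (sn_law noise).
by exists A => //; rewrite setTI.
Qed.

Lemma noise_others_u t0 j0 t i : (t, inl i) != (t0, j0) ->
  measurable_fun (setT : set (g_sigma_algebraType (noise_others t0 j0)))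
    (fun w => u t w 0 i).
Proof.
move=> ne _ A mA; apply: sub_sigma_algebra; exists t, (inl i); split=> //.
by exists A.
Qed.

Lemma noise_others_xi t0 j0 t : (t, inr tt) != (t0, j0) ->
  measurable_fun (setT : set (g_sigma_algebraType (noise_others t0 j0))) (xi t).
Proof.
move=> ne _ A mA; apply: sub_sigma_algebra; exists t, (inr tt); split=> //.
by exists A.
Qed.

End noise.

(** * Convexity and Lipschitz functions *)

Section l1_norm.
Context (R : realType) (d : nat).
Implicit Types x y v : 'rV[R]_d.

(** It dominates [enorm], so Lipschitz bounds carry over to it; as a plain sum over coordinates it
    makes rational approximation, measurability and axis-parallel moves elementary. *)
Definition l1norm v : R := \sum_(i < d) `|v 0 i|.

Lemma enorm_ge0 v : 0 <= enorm v.
Proof. exact: sqrtr_ge0. Qed.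

Lemma enorm_sqr v : enorm v ^+ 2 = \sum_(i < d) v 0 i ^+ 2.
Proof. by rewrite sqr_sqrtr// sumr_ge0// => i _; exact: sqr_ge0. Qed.

Lemma l1norm_ge0 v : 0 <= l1norm v.
Proof. by apply: sumr_ge0. Qed.

Lemma enorm_le_l1norm v : enorm v <= l1norm v.
Proof.
rewrite -(@ler_pXn2r _ 2)// ?nnegrE ?enorm_ge0 ?l1norm_ge0// enorm_sqr /l1norm.
suff : forall s : seq 'I_d, \sum_(i <- s) v 0 i ^+ 2 <= (\sum_(i <- s) `|v 0 i|) ^+ 2.
  exact.
elim=> [|a s ih]; first by rewrite !big_nil expr0n.
rewrite !big_cons sqrrD real_normK ?num_real// -addrA lerD2l.
apply: (le_trans ih); rewrite lerDr mulrn_wge0// mulr_ge0// sumr_ge0//.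
Qed.

(** Young's inequality with weight [c] is optimal at [c = enorm y / enorm x]. When one of the norms
    vanishes, [c] is sent to infinity or to 0 instead. *)
Lemma cauchy_schwarz x y : \sum_(i < d) x 0 i * y 0 i <= enorm x * enorm y.
Proof.
have h (c : R) : 0 < c -> \sum_(i < d) x 0 i * y 0 i <= (c * enorm x ^+ 2 + c^-1 *
  enorm y ^+ 2) / 2.
  move=> c0; rewrite !enorm_sqr !mulr_sumr -big_split /= mulr_suml.
  apply: ler_sum => i _; rewrite ler_pdivlMr//.
  rewrite -subr_ge0 (_ : _ - _ = c^-1 * (c * x 0 i - y 0 i) ^+ 2).
    by rewrite mulr_ge0 ?sqr_ge0// invr_ge0 ltW.
  by field; rewrite gt_eqF.
have [x0|x0] := eqVneq (enorm x) 0.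
  rewrite x0 mul0r; apply: (@le0_of_le_small _ _ (enorm y ^+ 2 / 2)) => e e0 _.
  have := h e^-1; rewrite invr_gt0 e0 => /(_ erefl) /le_trans; apply.
  by rewrite x0 invrK; lra.
have [y0|y0] := eqVneq (enorm y) 0.
  rewrite y0 mulr0; apply: (@le0_of_le_small _ _ (enorm x ^+ 2 / 2)) => e e0 _.
  have := h e e0 => /le_trans; apply.
  by rewrite y0; lra.
have x1 : 0 < enorm x by rewrite lt_neqAle eq_sym x0 enorm_ge0.
have y1 : 0 < enorm y by rewrite lt_neqAle eq_sym y0 enorm_ge0.
apply: (le_trans (h _ (divr_gt0 y1 x1))).
by rewrite le_eqVlt; apply/orP; left; apply/eqP; field; rewrite x0 y0.
Qed.

Lemma l1norm_scale_delta (a : R) i : l1norm (a *: delta_mx 0 i) = `|a|.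
Proof.
rewrite /l1norm (bigD1 i)//= big1 => [|j ji]; rewrite !mxE eqxx /=.
  by rewrite eqxx mulr1 addr0.
by rewrite (negbTE ji) mulr0 normr0.
Qed.

Lemma l1norm_rat_dense x e : 0 < e ->
  exists q : 'rV[rat]_d, l1norm (x - map_mx ratr q) < e.
Proof.
(* With [d + 1] in the denominator the sum of [d] errors stays strictly below [e], also for
   [d = 0]. *)
move=> e0; pose e' := e / d.+1%:R.
have e'0 : 0 < e' by rewrite divr_gt0.
have h i : exists q : rat, `|x 0 i - ratr q| < e'.
  have hx : x 0 i - e' < x 0 i + e' by move: e'0; lra.
  have [q] := rat_in_itvoo hx.
  by rewrite in_itv/= => /andP[h1 h2]; exists q; rewrite ltr_norml; lra.
have [f hf] := choice h.
exists (\row_i f i).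
apply: (@le_lt_trans _ _ (\sum_(i < d) e')).
  by apply: ler_sum => i _; rewrite !mxE; exact: ltW.
rewrite sumr_const card_ord -[e' *+ d]mulr_natr /e' mulrAC ltr_pdivrMr// ltr_pM2l//.
by rewrite ltr_nat.
Qed.

End l1_norm.

(* [F x z] is the infimum over rational points [q] of
   [F (map_mx ratr q) z + L * l1norm (x - map_mx ratr q)]. *)
Lemma measurable_lipschitz_comp (R : realType) (d : nat) dX
    (Xi : measurableType dX) (F : 'rV[R]_d -> Xi -> R) (L : R) dT
    (T : measurableType dT) (X : T -> 'rV[R]_d) (Z : T -> Xi) :
  0 < L -> (forall x, measurable_fun setT (F x)) ->
  (forall z x y, `|F x z - F y z| <= L * l1norm (x - y)) ->
  (forall i, measurable_fun setT (fun t => X t 0 i)) ->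
  measurable_fun setT Z -> measurable_fun setT (fun t => F (X t) (Z t)).
Proof.
move=> L0 mF lF mX mZ; apply: (measurability _ (RGenInftyO.measurableE R)) => //.
move=> _ [_ [c ->] <-]; rewrite setTI.
pose g (q : 'rV[rat]_d) t :=
  F (map_mx ratr q) (Z t) + L * l1norm (X t - map_mx ratr q).
have mg q : measurable_fun setT (g q).
  apply: measurable_funD; first by apply: measurableT_comp.
  apply: measurable_funM => //; apply: measurable_sum => i.
  apply: measurableT_comp => //.
  rewrite (_ : (fun x => _) = (fun t => X t 0 i - (map_mx ratr q : 'rV[R]_d) 0 i)).
    exact: measurable_funB.
  by apply/funext => t; rewrite !mxE.
rewrite (_ : _ @^-1` _ = \bigcup_q (g q @^-1` `]-oo, c[)).
  apply: countable_bigcupT_measurable => [|q]; first exact: countableP.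
  by rewrite -[X in measurable X]setTI; apply: mg => //; exact: measurable_itv.
apply/seteqP; split=> t /=.
  rewrite in_itv/= => tc; pose e := (c - F (X t) (Z t)) / (2 * L).
  have e0 : 0 < e by rewrite divr_gt0 ?subr_gt0// mulr_gt0.
  have [q hq] := l1norm_rat_dense (X t) e0.
  exists q => //=; rewrite in_itv/= /g.
  have := lF (Z t) (X t) (map_mx ratr q); rewrite distrC => /ler_normlP[_ h].
  have : L * l1norm (X t - map_mx ratr q) * 2 < c - F (X t) (Z t).
    by move: hq; rewrite /e ltr_pdivlMr ?mulr_gt0//; lra.
  lra.
move=> [q _ /=]; rewrite !in_itv/= /g.
have := lF (Z t) (X t) (map_mx ratr q) => /ler_normlP[_ h]; lra.
Qed.

Section convexity.
Context (R : realType) (d : nat).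
Local Notation V := 'rV[R]_d.
Implicit Types (G : V -> R) (x y v : V).

Lemma convex_functionP G : convex_function setT G ->
  forall x y t, 0 <= t -> t <= 1 ->
  G (t *: x + (1 - t) *: y) <= t * G x + (1 - t) * G y.
Proof.
move=> cG x y t t0 t1; have := cG (Itv01 t0 t1) x y.
by rewrite !inE => /(_ I I).
Qed.

Lemma convex_mean G (s : seq V) : convex_function setT G -> s != [::] ->
  G ((size s)%:R^-1 *: \sum_(x <- s) x) <= (size s)%:R^-1 * \sum_(x <- s) G x.
Proof.
move=> cG; case: s => // x s _; elim: s x => [|y s ih] x.
  by rewrite !big_seq1 invr1 scale1r mul1r.
set n : R := (size (y :: s))%:R.
have n0 : 0 < n by rewrite ltr0n.
have e : (size [:: x, y & s])%:R = 1 + n :> R by rewrite -[size _]/(1 + size (y ::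
  s))%N natrD.
have n1 : 0 < 1 + n by rewrite addr_gt0.
rewrite e ![\sum_(z <- x :: _) _]big_cons.
have := convex_functionP cG x (n^-1 *: \sum_(z <- y :: s) z)
  (t := (1 + n)^-1).
have -> : 1 - (1 + n)^-1 = n * (1 + n)^-1 by field; lra.
rewrite invr_ge0 (ltW n1) invf_le1// lerDl (ltW n0) => /(_ erefl erefl).
rewrite scalerA mulrAC divff ?gt_eqF// mul1r -scalerDr => /le_trans; apply.
rewrite mulrDr lerD2l [n / _]mulrC -mulrA ler_pM2l ?invr_gt0//.
by rewrite -ler_pdivlMl//; exact: ih.
Qed.

(** Convexity is used twice, with [s = r / d]. The point [y] lies between [y + s v] and [y - v],
    which bounds [s (G y - G (y - v))] by [G (y + s v) - G y]. In turn [y + s v] is the mean of the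
    [d] points [y + r v_i e_i]. *)
Lemma convex_coord_bound G y v r : convex_function setT G -> (0 < d)%N -> 0 < r ->
  G y - G (y - v) <=
  \sum_(i < d) (G (y + (r * v 0 i) *: delta_mx 0 i) - G y) / r.
Proof.
move=> cG d0 r0; set s := r / d%:R.
have dR : 0 < d%:R :> R by rewrite ltr0n.
have s0 : 0 < s by rewrite divr_gt0.
have s1 : 0 < 1 + s by rewrite addr_gt0.
have h1 : s * (G y - G (y - v)) <= G (y + s *: v) - G y.
  have := convex_functionP cG (y + s *: v) (y - v) (t := (1 + s)^-1).
  rewrite invr_ge0 (ltW s1) invf_le1// lerDl (ltW s0) => /(_ erefl erefl).
  have -> : 1 - (1 + s)^-1 = (1 + s)^-1 * s by field; lra.
  have -> : (1 + s)^-1 *: (y + s *: v) + ((1 + s)^-1 * s) *: (y - v) = y.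
    by apply/rowP => j; rewrite !mxE; field; lra.
  move=> h.
  have : (1 + s) * G y <= G (y + s *: v) + s * G (y - v).
    by rewrite -ler_pdivlMl// mulrDr mulrA.
  lra.
pose l := [seq y + (r * v 0 i) *: delta_mx 0 i | i <- index_enum 'I_d].
have sl : size l = d by rewrite size_map -sum1_size -[RHS]card_ord -sum1_card;
  exact: eq_bigl.
have l0 : l != [::] by rewrite -size_eq0 sl -lt0n.
have := convex_mean cG l0; rewrite sl !big_map.
have -> : d%:R^-1 *: \sum_(j < d) (y + (r * v 0 j) *: delta_mx 0 j) = y + s *: v.
  rewrite big_split /= sumr_const card_ord scalerDr -[y *+ d]scaler_nat scalerA mulVf
    ?gt_eqF//.
  rewrite scale1r {2}(row_sum_delta v) !scaler_sumr; congr (_ + _).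
  by apply: eq_bigr => i _; rewrite !scalerA /s; congr (_ *: _);
    rewrite mulrA [d%:R^-1 * r]mulrC.
move=> h2.
rewrite -mulr_suml sumrB sumr_const card_ord -[G y *+ d]mulr_natr.
have er : r = s * d%:R by rewrite /s divfK// gt_eqF.
rewrite ler_pdivlMr// {1}er mulrA -ler_pdivlMr// [_ * s]mulrC.
apply: (le_trans h1); rewrite mulrBl mulfK ?gt_eqF// lerD2r mulrC; exact: h2.
Qed.

(** Difference quotients along the sequence [1 / (n + 1)]: a countable limit is what makes gradients
    measurable in [measurable_gradient]. *)
Lemma derive_seq G x v : derivable G x v ->
  (fun n : nat => n.+1%:R * (G (n.+1%:R^-1 *: v + x) - G x)) @ \oo --> 'D_v G x.
Proof.
move=> dG; have : (h^-1 *: ((G \o shift x) (h *: v) - G x) @[h --> 0^'] --> 'D_v G x).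
  exact: dG.
have : (n.+1%:R^-1 : R) @[n --> \oo] --> (0 : R)^'.
  move=> A [e e0 eA]; have [N _ hN] := @cvg_harmonic R _ (nbhsx_ballx (0 : R) e e0).
  exists N => // n Nn; apply: eA => /=; first exact: hN.
  by rewrite invr_neq0// pnatr_eq0.
move=> c1 c2; have := cvg_comp _ _ c1 c2.
apply: cvg_trans; apply: near_eq_cvg; apply: nearW => n /=.
by rewrite invrK.
Qed.

Lemma convex_derive_le G x v : convex_function setT G -> derivable G x v ->
  'D_v G x <= G (x + v) - G x.
Proof.
move=> cG dG; have c := derive_seq dG.
rewrite -(cvg_lim _ c)//; apply: limr_le; first by apply/cvg_ex; exists ('D_v G x).
apply: nearW => n.
have n0 : 0 < n.+1%:R :> R by [].
have := convex_functionP cG (x + v) x (t := n.+1%:R^-1).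
rewrite invr_ge0 (ltW n0) invf_le1// ler1n => /(_ erefl erefl).
have -> : n.+1%:R^-1 *: (x + v) + (1 - n.+1%:R^-1) *: x = n.+1%:R^-1 *: v + x.
  by rewrite scalerDr scalerBl scale1r addrAC addrC [_ + (x - _)]addrC subrK.
by rewrite -ler_pdivlMl// => h; move: h; set k := _^-1; lra.
Qed.

Lemma derive_gradient G x v : differentiable G x ->
  'D_v G x = \sum_(i < d) v 0 i * gradient G x 0 i.
Proof.
move=> dG; rewrite deriveE// {1}(row_sum_delta v) linear_sum.
by apply: eq_bigr => i _; rewrite linearZ mxE deriveE.
Qed.

Lemma convex_gradient_le G x v : convex_function setT G -> differentiable G x ->
  \sum_(i < d) v 0 i * gradient G x 0 i <= G (x + v) - G x.
Proof.
move=> cG dG; rewrite -derive_gradient//.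
by apply: convex_derive_le => //; exact: diff_derivable.
Qed.

(** The gradient inequality in the directions [e_i] and [- e_i] is compared with the Lipschitz
    bound. The result makes the gradients of the samples integrable. *)
Lemma gradient_bound G x L i : convex_function setT G -> differentiable G x ->
  (forall x y, `|G x - G y| <= L * l1norm (x - y)) ->
  `|gradient G x 0 i| <= L.
Proof.
move=> cG dG lG.
have h (a : R) : `|a| = 1 -> a * gradient G x 0 i <= L.
  move=> a1; have := convex_gradient_le (a *: delta_mx 0 i) cG dG.
  rewrite (bigD1 i)//= big1 => [|j ji]; last first.
    by rewrite !mxE (negbTE ji) andbF mulr0 mul0r.
  rewrite !mxE !eqxx mulr1 addr0 -/(gradient G x) => /le_trans; apply.
  apply: (le_trans (ler_norm _)); apply: (le_trans (lG _ _)).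
  by rewrite addrAC subrr add0r l1norm_scale_delta a1 mulr1.
rewrite ler_norml; have := h 1; have := h (-1); rewrite normrN normr1.
by move=> /(_ erefl) + /(_ erefl); rewrite mul1r mulN1r; lra.
Qed.

(** The gradient inequality at [x + v] in direction [- v] bounds [G (x + v) - G x] by the slope at
    [x + v], and moving that slope to [x] costs [L * enorm v ^+ 2]. No integration along the segment
    occurs, at the price of [L] instead of [L / 2]. *)
Lemma smooth_upper G x v L : convex_function setT G ->
  (forall x, differentiable G x) -> 
  (forall x y, enorm (gradient G x - gradient G y) <= L * enorm (x - y)) ->
  G (x + v) <= G x + \sum_(i < d) v 0 i * gradient G x 0 i + L * enorm v ^+ 2.
Proof.
move=> cG dG lG.
have h1 := convex_gradient_le (- v) cG (dG (x + v)).
rewrite addrK in h1.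
have h2 : \sum_(i < d) v 0 i * (gradient G (x + v) - gradient G x) 0 i <= L * enorm v
  ^+ 2.
  have := lG (x + v) x; rewrite addrAC subrr add0r.
  set g := gradient G (x + v) - gradient G x => hg.
  apply: (@le_trans _ _ (enorm v * enorm g)); last first.
    by rewrite expr2 mulrA mulrC; apply: ler_wpM2r => //; exact: enorm_ge0.
  exact: cauchy_schwarz.
have e : \sum_(i < d) v 0 i * (gradient G (x + v) - gradient G x) 0 i =
  \sum_(i < d) v 0 i * gradient G (x + v) 0 i - \sum_(i < d) v 0 i * gradient G x 0 i.
  by rewrite -sumrB; apply: eq_bigr => i _; rewrite !mxE mulrBr.
have e2 : \sum_(i < d) (- v) 0 i * gradient G (x + v) 0 i = - \sum_(i < d) v 0 i *
  gradient G (x + v) 0 i.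
  by rewrite -sumrN; apply: eq_bigr => i _; rewrite !mxE mulNr.
rewrite e2 in h1; rewrite e in h2; lra.
Qed.

End convexity.

(** * Residual feedback *)

Lemma sqr_sumr_le (R : realType) (n : nat) (a : 'I_n -> R) :
  (\sum_(i < n) a i) ^+ 2 <= n%:R * \sum_(i < n) a i ^+ 2.
Proof.
rewrite expr2 mulr_suml.
apply: (@le_trans _ _ (\sum_(i < n) \sum_(j < n) (a i ^+ 2 + a j ^+ 2) / 2)).
  apply: ler_sum => i _; rewrite mulr_sumr; apply: ler_sum => j _.
  by have := sqr_ge0 (a i - a j); nra.
rewrite (eq_bigr (fun i => (n%:R * a i ^+ 2 + \sum_(j < n) a j ^+ 2) / 2)).
  rewrite -mulr_suml big_split /= -mulr_sumr sumr_const card_ord.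
  by rewrite -[X in _ + X]mulr_natl; lra.
by move=> i _; rewrite -mulr_suml big_split /= sumr_const card_ord -[_ *+ n]mulr_natl.
Qed.

Section query.
Context (R : realType) (d : nat) (Xi T : Type) (F : 'rV[R]_d -> Xi -> R)
  (delta : R) (u : nat -> T -> 'rV[R]_d) (xi : nat -> T -> Xi)
  (x : nat -> T -> 'rV[R]_d).

Definition query t w := F (x t w + delta *: u t w) (xi t w).

(** The default 0 merges the one-point estimator at time 0 with the residual one into a single
    formula, [residual_estimatorE]. *)
Definition last_query t w := if t is s.+1 then query s w else 0.

End query.

Section run_measurability.
Context (R : realType) (d : nat) dX (Xi : measurableType dX)
  (F : 'rV[R]_d -> Xi -> R) (L0 eta delta : R) (x0 : 'rV[R]_d).
Hypothesis L00 : 0 < L0.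
Hypothesis mF : forall y, measurable_fun setT (F y).
Hypothesis lipF : forall z y y', `|F y z - F y' z| <= L0 * l1norm (y - y').
Context dT (T : measurableType dT) (u : nat -> T -> 'rV[R]_d) (xi : nat -> T -> Xi)
  (x : nat -> T -> 'rV[R]_d).
Hypothesis run : residual_feedback_run F eta delta x0 u xi x.

Local Notation query := (query F delta u xi x).
Local Notation last_query := (last_query F delta u xi x).

Lemma residual_estimatorE t w i : residual_estimator F delta u xi x t w 0 i =
  (query t w - last_query t w) / delta * u t w 0 i.
Proof. by case: t => [|t]; rewrite !mxE ?subr0. Qed.

Lemma run_stepE t w i : x t.+1 w 0 i =
  x t w 0 i - eta * residual_estimator F delta u xi x t w 0 i.
Proof. by rewrite (run.2 t w) !mxE. Qed.

Lemma measurable_query t :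
  (forall i, measurable_fun setT (fun w => x t w 0 i)) ->
  (forall i, measurable_fun setT (fun w => u t w 0 i)) ->
  measurable_fun setT (xi t) -> measurable_fun setT (query t).
Proof.
move=> mx mu mxi; apply: (measurable_lipschitz_comp L00 mF lipF) => // i.
rewrite (_ : (fun _ => _) = (fun w => x t w 0 i + delta * u t w 0 i)).
  by apply: measurable_funD => //; exact: measurable_funM.
by apply/funext => w; rewrite !mxE.
Qed.

(** Only noise at times before [t] enters. Since the domain is an arbitrary measurable space, the
    induction also runs on [Omega] with the sigma-algebra that omits one component at time [t],
    which is how [adapted_x] uses it. *)
Lemma measurable_iterate t :
  (forall s i, (s < t)%N -> measurable_fun setT (fun w => u s w 0 i)) ->
  (forall s, (s < t)%N -> measurable_fun setT (xi s)) ->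
  forall s, (s <= t)%N -> forall i, measurable_fun setT (fun w => x s w 0 i).
Proof.
move=> mu mxi; elim/ltn_ind => s ih st i; case: s => [|s] in ih st *.
  by rewrite (_ : (fun _ => _) = (fun=> x0 0 i))//; apply/funext => w; rewrite run.1.
have mq r : (r <= s)%N -> measurable_fun setT (query r).
  move=> rs; apply: measurable_query => [j|j|].
  - by apply: ih => //; exact: (leq_trans rs (ltnW st)).
  - by apply: mu; exact: leq_ltn_trans rs st.
  - by apply: mxi; exact: leq_ltn_trans rs st.
rewrite (_ : (fun _ => _) = (fun w => x s w 0 i
    - eta * ((query s w - last_query s w) / delta * u s w 0 i))).
  apply: measurable_funB; first by apply: ih => //; exact: ltnW.
  apply: measurable_funM => //; apply: measurable_funM; last exact: mu.
  apply: measurable_funM => //; apply: measurable_funB; first exact: mq.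
  case: s mq {ih st} => [|s] mq; first exact: measurable_cst.
  exact: mq.
by apply/funext => w; rewrite run_stepE residual_estimatorE.
Qed.

End run_measurability.

(** * Adaptedness of the run, moments of the noise and of the samples *)

Section run.
Context (R : realType) (d : nat) dX (Xi : measurableType dX)
  (Q : probability Xi R) (F : 'rV[R]_d -> Xi -> R) (L0 sigma : R)
  dO (Omega : measurableType dO) (P : probability Omega R)
  (u : nat -> Omega -> 'rV[R]_d) (xi : nat -> Omega -> Xi)
  (eta delta : R) (x0 xstar : 'rV[R]_d) (x : nat -> Omega -> 'rV[R]_d).
Hypothesis L00 : 0 < L0.
Hypothesis cso : convex_stochastic_objective Q F L0 sigma.
Hypothesis noise : sampling_noise P Q u xi.
Hypothesis eta0 : 0 < eta.
Hypothesis delta0 : 0 < delta.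
Hypothesis run : residual_feedback_run F eta delta x0 u xi x.

Local Notation f := (objective Q F).
Local Notation g := (residual_estimator F delta u xi x).
Local Notation q := (query F delta u xi x).
Local Notation lastq := (last_query F delta u xi x).
Local Notation others t j := (g_sigma_algebraType (noise_others u xi t j)).
Local Notation N := (@std_normal R).
Local Notation m4 := (\int[N]_a (a ^+ 4)).

(* Measurability with respect to all the noise but the component [j] at time [t]. *)
Definition adapted (t : nat) (j : 'I_d + unit) (W : Omega -> R) : Prop :=
  measurable_fun (setT : set (others t j)) W.

Lemma measurable_sample y : measurable_fun setT (F y).
Proof. by have := integ_meas (cso_integrable cso y). Qed.

Lemma sample_lipschitz z y y' : `|F y z - F y' z| <= L0 * enorm (y - y').
Proof.
have [L lL h] := cso_lipschitz cso z; apply: (le_trans (h y y')).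
by rewrite ler_wpM2r// enorm_ge0.
Qed.

Lemma sample_lipschitz_l1 z y y' : `|F y z - F y' z| <= L0 * l1norm (y - y').
Proof.
apply: (le_trans (sample_lipschitz z y y')); apply: (ler_wpM2l (ltW L00)).
exact: enorm_le_l1norm.
Qed.

Lemma sample_lipschitz_sqr z y y' : (F y z - F y' z) ^+ 2 <= L0 ^+ 2 * enorm (y - y')
  ^+ 2.
Proof.
rewrite -exprMn -(real_normK (num_real _)).
by apply: lerXn2r; rewrite ?nnegrE ?mulr_ge0 ?enorm_ge0 ?(ltW L00)// sample_lipschitz.
Qed.

Lemma objectiveE y : f y = \int[Q]_z F y z.
Proof. by rewrite /objective unlock. Qed.

Lemma objective_lipschitz_l1 y y' : `|f y - f y'| <= L0 * l1norm (y - y').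
Proof.
rewrite !objectiveE -ExB; [|exact: cso_integrable cso _..].
have iB := integB (cso_integrable cso y) (cso_integrable cso y').
apply: (le_trans (le_normr_Rintegral measurableT iB)).
rewrite -[leRHS](Ex_cst Q); apply: Ex_le => [||z]; last exact: sample_lipschitz_l1.
  exact: integ_norm.
exact: integ_cst.
Qed.

Lemma convex_objective : convex_function setT f.
Proof.
move=> t a b _ _; rewrite !objectiveE.
have i y := cso_integrable cso y.
have : \int[Q]_z F (conv t a b) z <= \int[Q]_z (t%:num * F a z + (1 - t%:num) * F b
  z).
  apply: Ex_le => [||z]; first exact: i.
    by apply: integD; apply: integZ; exact: i.
  have := cso_convex cso z t; move=> /(_ a b).
  by rewrite !inE => /(_ I I).
rewrite ExD; [|by apply: integZ; exact: i..].
by rewrite !ExZ; [|exact: i..].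
Qed.

Section adapted_general.
Context dT (T : measurableType dT).

Lemma measurable_sample_comp (Y : T -> 'rV[R]_d) (Z : T -> Xi) :
  (forall i, measurable_fun setT (fun w => Y w 0 i)) -> measurable_fun setT Z ->
  measurable_fun setT (fun w => F (Y w) (Z w)).
Proof. exact: measurable_lipschitz_comp L00 measurable_sample sample_lipschitz_l1.
  Qed.

Lemma measurable_objective_comp (Y : T -> 'rV[R]_d) :
  (forall i, measurable_fun setT (fun w => Y w 0 i)) ->
  measurable_fun setT (fun w => f (Y w)).
Proof.
move=> mY.
exact: (@measurable_lipschitz_comp _ _ _ T (fun y _ => f y) L0 _ T Y id L00
  (fun y => measurable_cst _) (fun _ => objective_lipschitz_l1) mY (@measurable_id _
    _ _)).
Qed.

Lemma measurable_enorm_sqr (Y : T -> 'rV[R]_d) :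
  (forall i, measurable_fun setT (fun w => Y w 0 i)) ->
  measurable_fun setT (fun w => enorm (Y w) ^+ 2).
Proof.
move=> mY; under eq_fun do rewrite enorm_sqr.
by apply: measurable_sum => i; exact: measurable_funX.
Qed.

Lemma measurable_addZ (Y U : T -> 'rV[R]_d) c :
  (forall i, measurable_fun setT (fun w => Y w 0 i)) ->
  (forall i, measurable_fun setT (fun w => U w 0 i)) ->
  forall i, measurable_fun setT (fun w => (Y w + c *: U w) 0 i).
Proof.
move=> mY mU i.
rewrite (_ : (fun _ => _) = (fun w => Y w 0 i + c * U w 0 i)).
  by apply: measurable_funD => //; exact: measurable_funM.
by apply/funext => w; rewrite !mxE.
Qed.

Lemma measurable_subC (Y : T -> 'rV[R]_d) c :
  (forall i, measurable_fun setT (fun w => Y w 0 i)) ->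
  forall i, measurable_fun setT (fun w => (Y w - c) 0 i).
Proof.
move=> mY i; rewrite (_ : (fun _ => _) = (fun w => Y w 0 i - c 0 i)).
  exact: measurable_funB.
by apply/funext => w; rewrite !mxE.
Qed.

End adapted_general.

Lemma adapted_u t0 j0 t i : (t, inl i) != (t0, j0) -> adapted t0 j0 (fun w => u t w 0
  i).
Proof. exact: noise_others_u. Qed.

Lemma adapted_u_lt t0 j0 t i : (t < t0)%N -> adapted t0 j0 (fun w => u t w 0 i).
Proof.
by move=> tt0; apply: adapted_u; apply: contraTneq tt0 => -[->]; rewrite ltnn.
Qed.

Lemma adapted_xi_lt t0 j0 t : (t < t0)%N ->
  measurable_fun (setT : set (others t0 j0)) (xi t).
Proof.
by move=> tt0; apply: noise_others_xi; apply: contraTneq tt0 => -[->]; rewrite ltnn.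
Qed.

Lemma adapted_x t0 j0 t i : (t <= t0)%N -> adapted t0 j0 (fun w => x t w 0 i).
Proof.
move=> tt0.
apply: (@measurable_iterate _ _ _ _ F L0 eta delta x0 L00 measurable_sample
  sample_lipschitz_l1 _ (others t0 j0)
  u xi x run t0) => //.
- by move=> s k; exact: adapted_u_lt.
- by move=> s; exact: adapted_xi_lt.
Qed.

Lemma adapted_query t0 j0 t : (t < t0)%N -> adapted t0 j0 (q t).
Proof.
move=> tt0; apply: (measurable_query delta L00 measurable_sample sample_lipschitz_l1)
  => [i|i|].
- by apply: adapted_x; exact: ltnW.
- exact: adapted_u_lt.
- exact: adapted_xi_lt.
Qed.

Lemma adapted_last_query t j : adapted t j (lastq t).
Proof. by case: t => [|t]; [exact: measurable_cst|exact: adapted_query]. Qed.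

Lemma adapted_measurable t j W : adapted t j W -> measurable_fun setT W.
Proof. by move=> aW; exact: (measurable_forget (noise_others_measurable noise (t0 :=
  t) (j0 := j)) aW). Qed.

Lemma measurable_noise t i : measurable_fun setT (fun w => u t w 0 i).
Proof. exact: (noise_measurable_u noise). Qed.

Lemma measurable_xi t : measurable_fun setT (xi t).
Proof. exact: (sn_measurable noise). Qed.

Lemma measurable_x t i : measurable_fun setT (fun w => x t w 0 i).
Proof. exact: (adapted_measurable (@adapted_x t (inr tt) t i (leqnn _))). Qed.

Lemma measurable_q t : measurable_fun setT (q t).
Proof.
apply: (measurable_query delta L00 measurable_sample sample_lipschitz_l1) => [i|i|];
  [exact: measurable_x|exact: measurable_noise|exact: measurable_xi].
Qed.

Lemma measurable_estimator t i : measurable_fun setT (fun w => g t w 0 i).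
Proof.
under eq_fun do rewrite residual_estimatorE.
apply: measurable_funM; last exact: measurable_noise.
apply: measurable_funM => //; apply: measurable_funB; first exact: measurable_q.
exact: (adapted_measurable (@adapted_last_query t (inr tt))).
Qed.

Lemma coordinate_indepM t i (phi : R -> R) W : integ N phi ->
  adapted t (inl i) W -> integ P W ->
  integ P (fun w => phi (u t w 0 i) * W w) /\
  \int[P]_w (phi (u t w 0 i) * W w) = \int[N]_a phi a * \int[P]_w W w.
Proof.
move=> iphi aW iW.
exact: (indepM (measurable_noise t i) (noise_others_measurable noise (t0 := t) (j0 :=
  inl i))
  (@noise_u_indep _ _ _ _ _ _ _ _ _ _ noise t i) iphi aW iW).
Qed.

Lemma coordinate_mean t i W : adapted t (inl i) W -> integ P W ->
  integ P (fun w => u t w 0 i * W w) /\ \int[P]_w (u t w 0 i * W w) = 0.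
Proof.
move=> aW iW; have [h e] := coordinate_indepM (integ_normal_id R) aW iW.
by split=> //; rewrite e normal_mean mul0r.
Qed.

Lemma coordinate_sqr t i W : adapted t (inl i) W -> integ P W ->
  integ P (fun w => u t w 0 i ^+ 2 * W w) /\
  \int[P]_w (u t w 0 i ^+ 2 * W w) = \int[P]_w W w.
Proof.
move=> aW iW; have [h e] := coordinate_indepM (integ_normal_sqr R) aW iW.
by split=> //; rewrite e normal_sqr mul1r.
Qed.

Lemma noise_sqr t W : (forall i, adapted t (inl i) W) -> integ P W ->
  integ P (fun w => enorm (u t w) ^+ 2 * W w) /\
  \int[P]_w (enorm (u t w) ^+ 2 * W w) = d%:R * \int[P]_w W w.
Proof.
move=> aW iW.
have e w : enorm (u t w) ^+ 2 * W w = \sum_(i < d) u t w 0 i ^+ 2 * W w.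
  by rewrite enorm_sqr mulr_suml.
rewrite (_ : (fun w => _) = (fun w => \sum_(i < d) u t w 0 i ^+ 2 * W w));
  last exact/funext.
have ii i := (coordinate_sqr (aW i) iW).1.
split; first exact: integ_sum.
rewrite Ex_sum//; under eq_bigr do rewrite (coordinate_sqr (aW _) iW).2.
by rewrite sumr_const card_ord mulr_natl.
Qed.

Lemma noise_sqr_mean t : integ P (fun w => enorm (u t w) ^+ 2) /\
  \int[P]_w (enorm (u t w) ^+ 2) = d%:R.
Proof.
have [] := @noise_sqr t (fun=> 1) (fun i => measurable_cst _) (integ_cst P 1).
under eq_fun do rewrite mulr1.
by rewrite Ex_cst mulr1.
Qed.

(** The squared norm is a sum of [d] squares, so its square is at most [d] times the sum of fourth
    powers. The value of [m4] is left unevaluated: it will be absorbed by the threshold on [T]. *)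
Lemma noise_four t : integ P (fun w => (enorm (u t w) ^+ 2) ^+ 2) /\
  \int[P]_w ((enorm (u t w) ^+ 2) ^+ 2) <= d%:R ^+ 2 * m4.
Proof.
have c i := @coordinate_indepM t i _ (fun=> 1) (integ_normal_four R)
  (measurable_cst _) (integ_cst P 1).
have c1 i : integ P (fun w => u t w 0 i ^+ 4).
  by have [+ _] := c i; under eq_fun do rewrite mulr1.
have c2 i : \int[P]_w (u t w 0 i ^+ 4) = m4.
  have [_] := c i; under eq_Rintegral do rewrite mulr1.
  by rewrite Ex_cst mulr1.
have b w : (enorm (u t w) ^+ 2) ^+ 2 <= d%:R * \sum_(i < d) u t w 0 i ^+ 4.
  rewrite enorm_sqr; apply: (le_trans (sqr_sumr_le _)).
  by under eq_bigr do rewrite -exprM.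
have iS : integ P (fun w => d%:R * \sum_(i < d) u t w 0 i ^+ 4).
  by apply: integZ; exact: integ_sum.
have iu : integ P (fun w => (enorm (u t w) ^+ 2) ^+ 2).
  apply: (integ_le _ _ iS); last by move=> w; rewrite ger0_norm ?sqr_ge0.
  by apply: measurable_funX; apply: measurable_enorm_sqr => i;
    exact: measurable_noise.
split=> //; apply: (le_trans (Ex_le iu iS b)).
rewrite ExZ; last exact: integ_sum.
rewrite Ex_sum//; under eq_bigr do rewrite c2.
by rewrite sumr_const card_ord -[m4 *+ d]mulr_natl mulrA.
Qed.

(** The variance hypothesis concerns fixed points; freezing [Y], which does not look at [xi t],
    extends it to random ones. *)
Lemma sample_variance t (Y : Omega -> 'rV[R]_d) :
  (forall i, adapted t (inr tt) (fun w => Y w 0 i)) ->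
  integ P (fun w => (F (Y w) (xi t w) - f (Y w)) ^+ 2) /\
  \int[P]_w ((F (Y w) (xi t w) - f (Y w)) ^+ 2) <= sigma ^+ 2.
Proof.
move=> aY.
have [|s w|w||i e] := indep_ge0_le (measurable_xi t) (noise_others_measurable noise
  (t0 := t) (j0 := inr tt))
  (@noise_xi_indep _ _ _ _ _ _ _ _ _ _ noise t)
  (D := fun z w => (F (Y w) z - f (Y w)) ^+ 2) (B := fun=> sigma ^+ 2).
- have mY i : measurable_fun (setT : set (Xi * others t (inr tt)))
      (fun p => Y p.2 0 i).
    exact: (measurableT_comp (aY i) measurable_snd).
  apply: measurable_funX; apply: measurable_funB; first exact: measurable_sample_comp.
  exact: measurable_objective_comp.
- exact: sqr_ge0.
- by have := cso_variance cso (Y w); rewrite unlock.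
- exact: integ_cst.
- by split=> //; rewrite Ex_cst in e.
Qed.

Lemma sample_mean t (Y : Omega -> 'rV[R]_d) :
  (forall i, adapted t (inr tt) (fun w => Y w 0 i)) ->
  integ P (fun w => F (Y w) (xi t w)) ->
  integ P (fun w => f (Y w)) /\ \int[P]_w F (Y w) (xi t w) = \int[P]_w f (Y w).
Proof.
move=> aY iF.
have mD : measurable_fun (setT : set (Xi * others t (inr tt)))
    (fun p => (F (Y p.2) p.1)%:E).
  apply/measurable_EFinP; apply: measurable_sample_comp => // i.
  exact: (measurableT_comp (aY i) measurable_snd).
have [i e] := indep_integral (measurable_xi t) (noise_others_measurable noise (t0 :=
  t) (j0 := inr tt))
  (@noise_xi_indep _ _ _ _ _ _ _ _ _ _ noise t) mD iF.
have ef w : (\int[Q]_s (F (Y w) s)%:E)%E = (f (Y w))%:E.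
  rewrite objectiveE Ex_EFin//; exact: (cso_integrable cso (Y w)).
split; first by move: i; rewrite /= (_ : (fun w => _) = EFin \o (fun w => f (Y
  w)))//; apply/funext.
rewrite /Rintegral e; congr fine; apply: eq_integral => w _; exact: ef.
Qed.

Lemma sample_sqr t y : integ P (fun w => F y (xi t w) ^+ 2).
Proof.
have [i _] := @sample_variance t (fun=> y) (fun i => measurable_cst _).
apply: (integ_le _ _ (integD (integZ 2 i) (integ_cst P (2 * f y ^+ 2)))).
  by apply: measurable_funX; apply: measurableT_comp;
    [exact: measurable_sample|exact: measurable_xi].
move=> w; rewrite ger0_norm ?sqr_ge0//.
have := sqr_ge0 (F y (xi t w) - 2 * f y); lra.
Qed.

Lemma integ_sample_sqr t (Y : Omega -> 'rV[R]_d) :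
  (forall i, measurable_fun setT (fun w => Y w 0 i)) ->
  integ P (fun w => enorm (Y w - xstar) ^+ 2) ->
  integ P (fun w => F (Y w) (xi t w) ^+ 2).
Proof.
move=> mY iY.
apply: (integ_le _ _ (integD (integZ 2 (sample_sqr t xstar))
  (integZ (2 * L0 ^+ 2) iY))).
  by apply: measurable_funX; apply: measurable_sample_comp => //;
    exact: measurable_xi.
move=> w; rewrite ger0_norm ?sqr_ge0//.
have := sample_lipschitz_sqr (xi t w) (Y w) xstar.
have := sqr_ge0 (F (Y w) (xi t w) - 2 * F xstar (xi t w)); lra.
Qed.

(** * Second moments of the estimator and of the iterates *)

Lemma adapted_g t0 j0 t i : (t < t0)%N -> adapted t0 j0 (fun w => g t w 0 i).
Proof.
move=> tt0; rewrite /adapted; under eq_fun do rewrite residual_estimatorE.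
apply: measurable_funM; last exact: adapted_u_lt.
apply: measurable_funM => //; apply: measurable_funB; first exact: adapted_query.
by case: t tt0 => [|t] tt0; [exact: measurable_cst|apply: adapted_query; exact: ltnW].
Qed.

Lemma estimator_sqrE t w : enorm (g t w) ^+ 2 =
  delta^-1 ^+ 2 * (enorm (u t w) ^+ 2 * (q t w - lastq t w) ^+ 2).
Proof.
rewrite !enorm_sqr mulr_suml mulr_sumr; apply: eq_bigr => i _.
by rewrite residual_estimatorE; ring.
Qed.

Lemma measurable_estimator_sqr t : measurable_fun setT (fun w => enorm (g t w) ^+ 2).
Proof. by apply: measurable_enorm_sqr => i; exact: measurable_estimator. Qed.

Lemma integ_estimator_sqr0 : integ P (fun w => enorm (g 0%N w) ^+ 2).
Proof.
have iF := sample_sqr 0%N x0.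
have aF i : adapted 0%N (inl i) (fun w => F x0 (xi 0%N w) ^+ 2).
  apply: measurable_funX; apply: measurableT_comp; first exact: measurable_sample.
  exact: noise_others_xi.
have [iu _] := noise_sqr aF iF; have [i4 _] := noise_four 0%N.
apply: (integ_le (measurable_estimator_sqr 0%N) _ (integZ (delta^-1 ^+ 2)
  (integD (integZ 2 iu) (integZ (2 * L0 ^+ 2 * delta ^+ 2) i4)))) => w.
rewrite ger0_norm ?sqr_ge0// estimator_sqrE subr0.
apply: ler_wpM2l; first exact: sqr_ge0.
set a := q 0%N w; set b := F x0 _; set U := enorm _ ^+ 2.
have h : (a - b) ^+ 2 <= L0 ^+ 2 * (delta ^+ 2 * U).
  apply: (le_trans (sample_lipschitz_sqr _ _ _)); rewrite run.1 /U.
  rewrite !enorm_sqr [in leRHS]mulr_sumr le_eqVlt; apply/orP; left; apply/eqP.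
  by congr (_ * _); apply: eq_bigr => i _; rewrite !mxE; ring.
have U0 : 0 <= U by exact: sqr_ge0.
have h2 : a ^+ 2 <= 2 * b ^+ 2 + 2 * (L0 ^+ 2 * (delta ^+ 2 * U)).
  by have := sqr_ge0 (a - 2 * b); lra.
have := ler_wpM2l U0 h2; lra.
Qed.

(** The 16 is 12 + 4, the weights of the fourth moments of [u t.+1] and [u t] once their mixed
    product is split by the arithmetic-geometric mean inequality. The 8 is 4 + 4, one sample
    variance for each of the two queries, multiplied by the mean [d] of [enorm (u t.+1) ^+ 2]. *)
Definition second_moment_growth : R :=
  16 * L0 ^+ 2 * (d%:R ^+ 2 * m4) + 8 * sigma ^+ 2 * d%:R * delta^-1 ^+ 2.
Local Notation K := second_moment_growth.
Local Notation alpha := (4 * d%:R * L0 ^+ 2 * eta ^+ 2 * delta^-1 ^+ 2).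
Local Notation a2 t := (\int[P]_w (enorm (g t w) ^+ 2)).

(** The two queries are compared through the old query point [Y] with the new sample. Changing the
    point for one sample costs the Lipschitz constant times a step made of [eta *: g t] and the two
    perturbations; changing the sample at one point costs the variances [V'] and [V]. The terms
    [g t], [V'] and [V] do not look at [u t.+1], whose squared norm therefore averages to [d]. *)
Lemma estimator_recursion t : integ P (fun w => enorm (g t w) ^+ 2) ->
  integ P (fun w => enorm (g t.+1 w) ^+ 2) /\ a2 t.+1 <= alpha * a2 t + K.
Proof.
move=> ig.
pose Y w := x t w + delta *: u t w.
pose V' w := (F (Y w) (xi t.+1 w) - f (Y w)) ^+ 2.
pose V w := (F (Y w) (xi t w) - f (Y w)) ^+ 2.
have aY t0 j0 : (t <= t0)%N -> (forall i, (t, inl i) != (t0, j0)) ->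
    forall i, adapted t0 j0 (fun w => Y w 0 i).
  move=> tt0 ne; apply: measurable_addZ => i; first exact: adapted_x.
  exact: adapted_u.
have ltne (i : 'I_d) (j0 : 'I_d + unit) : (t, inl i) != (t.+1, j0) by apply/eqP =>
  -[/esym/eqP]; rewrite gtn_eqF.
have nexi (i : 'I_d) : (t, inl i : 'I_d + unit) != (t, inr tt).
  by apply/eqP => -[].
have [iV' eV'] := @sample_variance t.+1 Y (aY _ _ (leqnSn t) (fun i => ltne i _)).
have [iV eV] := @sample_variance t Y (aY _ (inr tt) (leqnn t) nexi).
have aV' i : adapted t.+1 (inl i) V'.
  apply: measurable_funX; apply: measurable_funB.
    apply: measurable_sample_comp; first exact: aY.
    by apply: noise_others_xi; apply/eqP => -[].
  by apply: measurable_objective_comp; exact: aY.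
have aV i : adapted t.+1 (inl i) V.
  apply: measurable_funX; apply: measurable_funB.
    apply: measurable_sample_comp; first exact: aY.
    exact: adapted_xi_lt.
  by apply: measurable_objective_comp; exact: aY.
have ag i : adapted t.+1 (inl i) (fun w => enorm (g t w) ^+ 2).
  by apply: measurable_enorm_sqr => k; exact: adapted_g.
have [i1 e1] := noise_sqr ag ig.
have [i2 e2] := noise_sqr aV' iV'.
have [i3 e3] := noise_sqr aV iV.
have [i4 e4] := noise_four t.+1.
have [i5 e5] := noise_four t.
pose B w := delta^-1 ^+ 2 * (4 * L0 ^+ 2 * eta ^+ 2 * (enorm (u t.+1 w) ^+ 2 * enorm
  (g t w) ^+ 2)
  + (4 * (enorm (u t.+1 w) ^+ 2 * V' w) + 4 * (enorm (u t.+1 w) ^+ 2 * V w)))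
  + (12 * L0 ^+ 2 * (enorm (u t.+1 w) ^+ 2) ^+ 2 + 4 * L0 ^+ 2 * (enorm (u t w) ^+ 2)
    ^+ 2).
have j1 := integZ (4 * L0 ^+ 2 * eta ^+ 2) i1.
have j23 := integD (integZ 4 i2) (integZ 4 i3).
have j45 := integD (integZ (12 * L0 ^+ 2) i4) (integZ (4 * L0 ^+ 2) i5).
have iB : integ P B by apply: integD => //; apply: integZ; exact: integD.
have bd w : enorm (g t.+1 w) ^+ 2 <= B w.
  rewrite estimator_sqrE /B /=.
  have h1 := sample_lipschitz_sqr (xi t.+1 w) (x t.+1 w + delta *: u t.+1 w) (Y w).
  have h2 : enorm (x t.+1 w + delta *: u t.+1 w - Y w) ^+ 2 <=
      2 * eta ^+ 2 * enorm (g t w) ^+ 2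
      + 4 * delta ^+ 2 * (enorm (u t.+1 w) ^+ 2 + enorm (u t w) ^+ 2).
    rewrite !enorm_sqr -big_split /= !mulr_sumr -big_split /=.
    apply: ler_sum => i _; rewrite !mxE (run_stepE run).
    set gi := residual_estimator _ _ _ _ _ _ _ _ _.
    have := sqr_ge0 (eta * gi + delta * (u t.+1 w 0 i - u t w 0 i)).
    have := sqr_ge0 (delta * (u t.+1 w 0 i + u t w 0 i)).
    lra.
  have h3 : (q t.+1 w - q t w) ^+ 2 <=
    2 * (F (x t.+1 w + delta *: u t.+1 w) (xi t.+1 w) - F (Y w) (xi t.+1 w)) ^+ 2
    + 4 * V' w + 4 * V w.
    rewrite -[q t w]/(F (Y w) (xi t w)) -[q t.+1 w]/(F _ _) /V' /V.
    set A := F _ _; set B1 := F (Y w) (xi t.+1 w); set B2 := F _ (xi t w);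
      set c := f _.
    have := sqr_ge0 ((A - B1) - (B1 - B2)); have := sqr_ge0 ((B1 - c) + (B2 - c)).
    lra.
  set U' := enorm (u t.+1 w) ^+ 2 in h2 *; set U := enorm (u t w) ^+ 2 in h2 *.
  have U'0 : 0 <= U' by exact: sqr_ge0.
  have L2 : 0 <= L0 ^+ 2 by exact: sqr_ge0.
  have h4 := ler_wpM2l L2 h2.
  set G := enorm (g t w) ^+ 2 in h4 *.
  have h5 : (q t.+1 w - q t w) ^+ 2 <= 4 * L0 ^+ 2 * eta ^+ 2 * G
      + 8 * L0 ^+ 2 * delta ^+ 2 * (U' + U) + 4 * V' w + 4 * V w by lra.
  have dl : delta^-1 ^+ 2 * delta ^+ 2 = 1.
    by rewrite -exprMn mulVf ?expr1n// gt_eqF.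
  have := ler_wpM2l (sqr_ge0 delta^-1) (ler_wpM2l U'0 h5).
  have -> : delta^-1 ^+ 2 * (U' * (4 * L0 ^+ 2 * eta ^+ 2 * G +
     8 * L0 ^+ 2 * delta ^+ 2 * (U' + U) + 4 * V' w + 4 * V w)) =
     delta^-1 ^+ 2 * (4 * L0 ^+ 2 * eta ^+ 2 * (U' * G) + (4 * (U' * V' w) + 4 * (U'
       * V w)))
     + 8 * L0 ^+ 2 * (delta^-1 ^+ 2 * delta ^+ 2) * (U' * U' + U' * U) by ring.
  rewrite dl => /le_trans; apply; rewrite lerD2l.
  have := mulr_ge0 L2 (sqr_ge0 (U' - U)); lra.
have ig' : integ P (fun w => enorm (g t.+1 w) ^+ 2).
  apply: (integ_le (measurable_estimator_sqr _) _ iB) => w.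
  by rewrite ger0_norm ?sqr_ge0.
split=> //; apply: (le_trans (Ex_le ig' iB bd)).
rewrite /B ExD; [|by apply: integZ; exact: integD|exact: j45].
rewrite ExZ; last exact: integD.
rewrite (ExD j1 j23) (ExD (integZ 4 i2) (integZ 4 i3)).
rewrite (ExD (integZ (12 * L0 ^+ 2) i4) (integZ (4 * L0 ^+ 2) i5)).
rewrite !ExZ// e1 e2 e3 /K.
have d2 : 0 <= delta^-1 ^+ 2 * d%:R :> R by rewrite mulr_ge0 ?sqr_ge0.
have := ler_wpM2l d2 eV'; have := ler_wpM2l d2 eV.
have := ler_wpM2l (sqr_ge0 L0) e4; have := ler_wpM2l (sqr_ge0 L0) e5.
rewrite -/V -/V'; lra.
Qed.

Lemma integ_estimator_sqr t : integ P (fun w => enorm (g t w) ^+ 2).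
Proof.
elim: t => [|t ih]; first exact: integ_estimator_sqr0.
by have [] := estimator_recursion ih.
Qed.

Lemma sum_second_moments T : 2 * alpha <= 1 ->
  \sum_(t < T) a2 t <= 2 * a2 0%N + 2 * K * T%:R.
Proof.
move=> al.
have a0 t : 0 <= a2 t by apply: Rintegral_ge0 => w _; exact: sqr_ge0.
(* The extra term makes the induction close: [2 * a2 T.+1] is at most [a2 T + 2 * K] because
   [2 * alpha <= 1]. *)
suff : \sum_(t < T) a2 t + 2 * a2 T <= 2 * a2 0%N + 2 * K * T%:R.
  by have := a0 T; lra.
elim: T => [|T ih]; first by rewrite big_ord0; lra.
rewrite big_ord_recr /= -natr1.
have [_ h] := estimator_recursion (integ_estimator_sqr T).
have := ler_wpM2r (a0 T) al; lra.
Qed.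

Lemma measurable_dist_sqr t : measurable_fun setT (fun w => enorm (x t w - xstar) ^+
  2).
Proof. by apply: measurable_enorm_sqr; apply: measurable_subC => i;
  exact: measurable_x. Qed.

Lemma integ_dist_sqr t : integ P (fun w => enorm (x t w - xstar) ^+ 2).
Proof.
elim: t => [|t ih].
  by under eq_fun do rewrite run.1; exact: integ_cst.
apply: (integ_le (measurable_dist_sqr _) _
  (integD (integZ 2 ih) (integZ (2 * eta ^+ 2) (integ_estimator_sqr t)))) => w.
rewrite ger0_norm ?sqr_ge0// !enorm_sqr !mulr_sumr -big_split /=.
apply: ler_sum => i _; rewrite !mxE (run_stepE run).
set gi := residual_estimator _ _ _ _ _ _ _ _ _.
by have := sqr_ge0 (x t w 0 i - xstar 0 i + eta * gi); lra.
Qed.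

Lemma integ_perturbed_dist_sqr t :
  integ P (fun w => enorm (x t w + delta *: u t w - xstar) ^+ 2).
Proof.
apply: (integ_le _ _ (integD (integZ 2 (integ_dist_sqr t))
  (integZ (2 * delta ^+ 2) (noise_sqr_mean t).1))).
  apply: measurable_enorm_sqr; apply: measurable_subC; apply: measurable_addZ => i.
    exact: measurable_x.
  exact: measurable_noise.
move=> w; rewrite ger0_norm ?sqr_ge0// !enorm_sqr !mulr_sumr -big_split /=.
apply: ler_sum => i _; rewrite !mxE.
by have := sqr_ge0 (x t w 0 i - xstar 0 i - delta * u t w 0 i); lra.
Qed.

Lemma integ_query_sqr t : integ P (fun w => q t w ^+ 2).
Proof.
apply: (@integ_sample_sqr t (fun w => x t w + delta *: u t w) _
  (integ_perturbed_dist_sqr t)); apply: measurable_addZ => i.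
  exact: measurable_x.
exact: measurable_noise.
Qed.

Lemma integ_query t : integ P (q t).
Proof. by apply: integ_sq; [exact: measurable_q|exact: integ_query_sqr]. Qed.

Lemma integ_coord_dist_sqr t i : integ P (fun w => (x t w 0 i - xstar 0 i) ^+ 2).
Proof.
apply: (integ_le _ _ (integ_dist_sqr t)).
  by apply: measurable_funX; apply: measurable_funB => //; exact: measurable_x.
move=> w; rewrite ger0_norm ?sqr_ge0// enorm_sqr (bigD1 i)//= !mxE lerDl.
by apply: sumr_ge0 => j _; exact: sqr_ge0.
Qed.

Lemma adapted_coord_dist t j i : adapted t j (fun w => x t w 0 i - xstar 0 i).
Proof. by apply: measurable_funB => //; exact: adapted_x. Qed.

Lemma integ_noise_dist_query t i :
  integ P (fun w => u t w 0 i * (x t w 0 i - xstar 0 i) * q t w).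
Proof.
apply: integ_mulsq.
- by apply: measurable_funM; [exact: measurable_noise|apply: measurable_funB => //;
  exact: measurable_x].
- exact: measurable_q.
- under eq_fun do rewrite exprMn.
  apply: (coordinate_sqr _ (integ_coord_dist_sqr t i)).1.
  by apply: measurable_funX; exact: adapted_coord_dist.
- exact: integ_query_sqr.
Qed.

(** * Stein's identity along one coordinate and the one-step inequality *)

Local Notation C := ((tilt_const R + 2) * L0 * delta^-1).

(** [normal_stein] is applied to the sample as a function of the [i]-th coordinate of [u t] alone,
    with Lipschitz constant [delta * L0]. The remainder keeps a second factor [r], which disappears
    after division by [r] in the limit. *)
Lemma stein_coord t i r : 0 < r ->
  integ P (fun w => F (x t w + delta *: u t w
    + (r * (x t w - xstar) 0 i) *: delta_mx 0 i) (xi t w)) /\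
  \int[P]_w F (x t w + delta *: u t w
    + (r * (x t w - xstar) 0 i) *: delta_mx 0 i) (xi t w) - \int[P]_w q t w <=
  r * (delta^-1 * \int[P]_w (u t w 0 i * (x t w 0 i - xstar 0 i) * q t w)
       + r * (C * \int[P]_w ((x t w 0 i - xstar 0 i) ^+ 2))).
Proof.
move=> r0.
pose v w := x t w 0 i - xstar 0 i.
(* Adding [S w] to coordinate [i] of [u t w] moves the query point by [r * v w] along that axis. In
   [Y] this coordinate is removed, so neither [S] nor [Y] involves the variable to be integrated
   out. *)
pose S w := r * delta^-1 * v w.
pose Y w : 'rV[R]_d := x t w + delta *: (\row_j (if j == i then 0 else u t w 0 j)).
pose Phi a w := F (Y w + (delta * a) *: delta_mx 0 i) (xi t w).
have YE s w : Y w + (delta * (u t w 0 i + s)) *: delta_mx 0 i =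
    x t w + delta *: u t w + (delta * s) *: delta_mx 0 i.
  apply/rowP => j; rewrite !mxE eqxx /=; case: eqP => [->|_] /=; ring.
have PhiS w : Phi (u t w 0 i + S w) w =
    F (x t w + delta *: u t w + (r * (x t w - xstar) 0 i) *: delta_mx 0 i) (xi t w).
  rewrite /Phi YE; congr (F (_ + _ *: _) _).
  by rewrite /S /v !mxE; field; rewrite gt_eqF.
have Phi0 w : Phi (u t w 0 i) w = q t w.
  by have := YE 0 w; rewrite /Phi addr0 => ->; rewrite mulr0 scale0r addr0.
have mvw : measurable_fun setT v by apply: measurable_funB => //; exact: measurable_x.
have iv2 := integ_coord_dist_sqr t i.
have iS : integ P (fun w => F (x t w + delta *: u t w
    + (r * (x t w - xstar) 0 i) *: delta_mx 0 i) (xi t w)).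
  have mS : measurable_fun setT (fun w => F (x t w + delta *: u t w
    + (r * (x t w - xstar) 0 i) *: delta_mx 0 i) (xi t w)).
    apply: measurable_sample_comp; last exact: measurable_xi.
    move=> j; rewrite (_ : (fun _ => _) = (fun w => (x t w 0 j + delta * u t w 0 j)
      + r * v w * (delta_mx 0 i : 'rV[R]_d) 0 j)).
      apply: measurable_funD.
        apply: measurable_funD; first exact: measurable_x.
        by apply: measurable_funM => //; exact: measurable_noise.
      by apply: measurable_funM => //; exact: measurable_funM.
    by apply/funext => w; rewrite /v !mxE.
  have ib : integ P (fun w => `|q t w| + L0 * r * (1 + v w ^+ 2)).
    apply: integD; first exact: integ_norm (integ_query t).
    by apply: integZ; apply: integD => //; exact: integ_cst.
  apply: (integ_le mS _ ib) => w.
  have := sample_lipschitz_l1 (xi t w) (x t w + delta *: u t w + (r * (x t w - xstar)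
    0 i) *: delta_mx 0 i)
    (x t w + delta *: u t w).
  rewrite [X in l1norm X](_ : _ = (r * (x t w - xstar) 0 i) *: delta_mx 0 i);
    last first.
    by rewrite addrC addKr.
  rewrite l1norm_scale_delta normrM (gtr0_norm r0).
  have -> : (x t w - xstar) 0 i = v w by rewrite /v !mxE.
  rewrite -/(q t w) => h.
  have : `|v w| <= 1 + v w ^+ 2.
    rewrite -(real_normK (num_real (v w))).
    by have := sqr_ge0 (`|v w| - 1); have := normr_ge0 (v w); nra.
  move=> h2; have := ler_wpM2l (mulr_ge0 (ltW L00) (ltW r0)) h2.
  move: h; set A := F _ _ => h; have := ler_normD (A - q t w) (q t w).
  rewrite subrK; move: h; lra.
split=> //.
have iuq := integ_noise_dist_query t i.
pose D a w := Phi (a + S w) w - Phi a w - S w * (a * Phi a w).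
pose B w := (tilt_const R + 2) * (delta * L0) * S w ^+ 2.
have aS : adapted t (inl i) S.
  by apply: measurable_funM => //; exact: adapted_coord_dist.
have aY j : adapted t (inl i) (fun w => Y w 0 j).
  rewrite (_ : (fun _ => _) = (fun w => x t w 0 j
     + delta * (if j == i then 0 else u t w 0 j))); last first.
    by apply/funext => w; rewrite !mxE.
  apply: measurable_funD; first exact: adapted_x.
  apply: measurable_funM => //; case: eqP => [_|ji] //.
  by apply: adapted_u; apply/eqP => -[].
have mPhi (h : R * others t (inl i) -> R) : measurable_fun setT h ->
    measurable_fun setT (fun p => Phi (h p) p.2).
  move=> mh; apply: measurable_sample_comp; last first.
    apply: (@measurableT_comp _ _ _ _ _ _ (xi t : others t (inl i) -> Xi));
      last exact: measurable_snd.
    by apply: noise_others_xi; apply/eqP => -[].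
  move=> j; rewrite (_ : (fun _ => _) = (fun p => Y p.2 0 j
      + delta * h p * (delta_mx 0 i : 'rV[R]_d) 0 j)).
    apply: measurable_funD.
      exact: (measurableT_comp (aY j) measurable_snd).
    by apply: measurable_funM => //; exact: measurable_funM.
  by apply/funext => p; rewrite !mxE.
have mS2 : measurable_fun setT (fun p : R * others t (inl i) => S p.2).
  exact: (measurableT_comp aS measurable_snd).
have mD : measurable_fun setT (fun p : R * others t (inl i) => D p.1 p.2).
  apply: measurable_funB.
    apply: measurable_funB; first by apply: mPhi; exact: measurable_funD.
    exact: mPhi.
  by apply: measurable_funM => //; apply: measurable_funM => //; exact: mPhi.
have DE w : D (u t w 0 i) w = F (x t w + delta *: u t w
    + (r * (x t w - xstar) 0 i) *: delta_mx 0 i) (xi t w) - q t w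
    - r * delta^-1 * (u t w 0 i * v w * q t w).
  by rewrite /D PhiS Phi0 /S; ring.
have i12 := integB iS (integ_query t).
have iD : integ P (fun w => D (u t w 0 i) w).
  rewrite (funext DE); apply: integB => //; exact: integZ.
have iB : integ P B.
  rewrite (_ : B = (fun w => (tilt_const R + 2) * (delta * L0) * (r * delta^-1) ^+ 2
    * v w ^+ 2)).
    exact: integZ.
  by apply/funext => w; rewrite /B /S; ring.
(* With [w] frozen, [S w] is a constant of arbitrary size, which is why [normal_stein] puts no
   restriction on the shift. *)
have st w : integ N (D ^~ w) /\ \int[N]_a D a w <= B w.
  apply: (@normal_stein R (delta * L0) (S w) (Phi ^~ w)).
  - by rewrite mulr_ge0 ?ltW.
  - apply: measurable_sample_comp => [j|]; last exact: measurable_cst.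
    rewrite (_ : (fun _ => _) = (fun a : R => Y w 0 j
      + delta * a * (delta_mx 0 i : 'rV[R]_d) 0 j)).
      by apply: measurable_funD => //; apply: measurable_funM => //;
        exact: measurable_funM.
    by apply/funext => a; rewrite !mxE.
  - move=> a b; apply: (le_trans (sample_lipschitz_l1 _ _ _)).
    rewrite opprD addrACA subrr add0r -scalerBl -mulrBr l1norm_scale_delta.
    by rewrite normrM (gtr0_norm delta0) mulrCA mulrA.
have := indep_le (measurable_noise t i) (noise_others_measurable noise (t0 := t) (j0
  := inl i))
  (@noise_u_indep _ _ _ _ _ _ _ _ _ _ noise t i) mD iD (fun w => (st w).1)
  (fun w => (st w).2) iB.
rewrite (eq_Ex _ DE) ExB//; last exact: integZ.
rewrite (ExB iS (integ_query t)) (ExZ _ iuq).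
rewrite (eq_Ex _ (_ : B =1 (fun w => (tilt_const R + 2) * (delta * L0) * (r *
  delta^-1) ^+ 2 * v w ^+ 2))); last first.
  by move=> w; rewrite /B /S; ring.
rewrite (ExZ _ iv2) => h.
have e : (tilt_const R + 2) * (delta * L0) * (r * delta^-1) ^+ 2 = r * r * C.
  by field; rewrite gt_eqF.
rewrite e in h; move: h; rewrite /v; lra.
Qed.

Lemma integ_last_query_sqr t : integ P (fun w => lastq t w ^+ 2).
Proof. by case: t => [|t]; [exact: (integ_cst P (0 ^+ 2))|exact: integ_query_sqr].
  Qed.

Lemma integ_perturbed_min_sqr t : integ P (fun w => F (xstar + delta *: u t w) (xi t
  w) ^+ 2).
Proof.
apply: (@integ_sample_sqr t (fun w => xstar + delta *: u t w)) => [i|].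
  by apply: measurable_addZ => // j; exact: measurable_noise.
rewrite (_ : (fun _ => _) = (fun w => delta ^+ 2 * enorm (u t w) ^+ 2)).
  exact: integZ (noise_sqr_mean t).1.
apply/funext => w; rewrite !enorm_sqr mulr_sumr; apply: eq_bigr => i _.
by rewrite !mxE; ring.
Qed.

Lemma integ_perturbed_min t : integ P (fun w => F (xstar + delta *: u t w) (xi t w)).
Proof.
apply: integ_sq; last exact: integ_perturbed_min_sqr.
by apply: measurable_sample_comp; [apply: measurable_addZ => // j;
  exact: measurable_noise|exact: measurable_xi].
Qed.

Definition inner t w := \sum_(i < d) g t w 0 i * (x t w 0 i - xstar 0 i).

Lemma inner_mean t : integ P (inner t) /\ \int[P]_w inner t w =
  \sum_(i < d) delta^-1 * \int[P]_w (u t w 0 i * (x t w 0 i - xstar 0 i) * q t w).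
Proof.
have c i := @coordinate_mean t i (fun w => (x t w 0 i - xstar 0 i) * lastq t w).
have aW i : adapted t (inl i) (fun w => (x t w 0 i - xstar 0 i) * lastq t w).
  by apply: measurable_funM; [exact: adapted_coord_dist|exact: adapted_last_query].
have iW i : integ P (fun w => (x t w 0 i - xstar 0 i) * lastq t w).
  apply: integ_mulsq; [|exact: (adapted_measurable (@adapted_last_query t (inr tt)))
    |exact: integ_coord_dist_sqr|exact: integ_last_query_sqr].
  by apply: measurable_funB => //; exact: measurable_x.
have E w : inner t w = \sum_(i < d)
    (delta^-1 * (u t w 0 i * (x t w 0 i - xstar 0 i) * q t w)
     - delta^-1 * (u t w 0 i * ((x t w 0 i - xstar 0 i) * lastq t w))).
  by apply: eq_bigr => i _; rewrite residual_estimatorE; ring.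
have i1 i := integZ delta^-1 (integ_noise_dist_query t i).
have i2 i := integZ delta^-1 (c i (aW i) (iW i)).1.
have i12 i := integB (i1 i) (i2 i).
rewrite (funext E); split; first exact: integ_sum.
rewrite Ex_sum//; apply: eq_bigr => i _.
rewrite (ExB (i1 i) (i2 i)) (ExZ _ (integ_noise_dist_query t i)).
by rewrite (ExZ _ (c i (aW i) (iW i)).1) (c i (aW i) (iW i)).2 mulr0 subr0.
Qed.

Lemma descent t : (0 < d)%N ->
  \int[P]_w q t w - \int[P]_w F (xstar + delta *: u t w) (xi t w) <=
  \int[P]_w inner t w.
Proof.
move=> d0; rewrite (inner_mean t).2 -subr_le0.
(* The coefficient of [r] is independent of [r], and is a real bound thanks to the finite second
   moments of [x t - xstar]. *)
apply: (@le0_of_le_small _ _ (\sum_(i < d) C * \int[P]_w ((x t w 0 i - xstar 0 i) ^+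
  2))) => r r0 _.
rewrite lerBlDr -ExB; [|exact: integ_query|exact: integ_perturbed_min].
pose Fs i w := F (x t w + delta *: u t w + (r * (x t w - xstar) 0 i) *: delta_mx 0 i)
  (xi t w).
have iFs i : integ P (fun w => r^-1 * (Fs i w - q t w)).
  apply: integZ; apply: integB (integ_query t); exact: (stein_coord t i r0).1.
have bd w : q t w - F (xstar + delta *: u t w) (xi t w) <=
    \sum_(i < d) r^-1 * (Fs i w - q t w).
  have := convex_coord_bound (x t w + delta *: u t w) (x t w - xstar) (cso_convex cso
    (xi t w)) d0 r0.
  have -> : x t w + delta *: u t w - (x t w - xstar) = xstar + delta *: u t w.
    by apply/rowP => j; rewrite !mxE; ring.
  by move=> /le_trans; apply; apply: ler_sum => i _; rewrite mulrC.
apply: (le_trans (Ex_le (integB (integ_query t) (integ_perturbed_min t)) (integ_sum _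
  iFs) bd)).
rewrite Ex_sum// mulr_sumr -big_split /=; apply: ler_sum => i _.
have [iF1 h] := stein_coord t i r0.
rewrite ExZ; last exact: integB (integ_query t).
rewrite (ExB iF1 (integ_query t)) ler_pdivrMl//.
by apply: (le_trans h); rewrite addrC.
Qed.

(** * Telescoping the squared distance and averaging the iterates *)

Local Notation D t := (\int[P]_w (enorm (x t w - xstar) ^+ 2)).

Lemma dist_step t : D t.+1 = D t - 2 * eta * \int[P]_w inner t w + eta ^+ 2 * a2 t.
Proof.
have E w : enorm (x t.+1 w - xstar) ^+ 2 = enorm (x t w - xstar) ^+ 2
    - 2 * eta * inner t w + eta ^+ 2 * enorm (g t w) ^+ 2.
  rewrite !enorm_sqr /inner !mulr_sumr -sumrB -big_split /=.
  by apply: eq_bigr => i _; rewrite !mxE (run_stepE run); ring.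
have [ii _] := inner_mean t.
rewrite (eq_Ex _ E) ExD; last 2 first.
- by apply: integB; [exact: integ_dist_sqr|exact: integZ].
- by apply: integZ; exact: integ_estimator_sqr.
rewrite (ExB (integ_dist_sqr t) (integZ _ ii)) (ExZ _ ii).
by rewrite (ExZ _ (integ_estimator_sqr t)).
Qed.

Lemma integ_sample_x t : integ P (fun w => F (x t w) (xi t w)).
Proof.
apply: integ_sq; first by apply: measurable_sample_comp; [move=> i;
  exact: measurable_x|exact: measurable_xi].
by apply: integ_sample_sqr; [move=> i; exact: measurable_x|exact: integ_dist_sqr].
Qed.

Lemma sample_mean_x t : integ P (fun w => f (x t w)) /\
  \int[P]_w F (x t w) (xi t w) = \int[P]_w f (x t w).
Proof.
by apply: sample_mean; [move=> i; exact: adapted_x|exact: integ_sample_x].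
Qed.

Hypothesis xmin : forall y, f xstar <= f y.

(** The number [b] abstracts the bias of the perturbation, so that one regret bound serves the
    Lipschitz and the smooth case. It is paid twice: once at the iterates and once at the
    minimizer. *)
Theorem averaged_iterate_bound T b : (0 < d)%N -> (0 < T)%N -> 2 * alpha <= 1 ->
  (forall t, \int[P]_w F (x t w) (xi t w) <= \int[P]_w q t w + b) ->
  (forall t, \int[P]_w F (xstar + delta *: u t w) (xi t w) <= f xstar + b) ->
  integ P (fun w => f (average_iterate T x w)) /\
  \int[P]_w f (average_iterate T x w) - f xstar <=
  enorm (x0 - xstar) ^+ 2 / (2 * eta * T%:R)
  + eta * (a2 0%N / T%:R + K) + 2 * b.
Proof.
move=> d0 T0 al b1 b2.
have TR : 0 < T%:R :> R by rewrite ltr0n.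
have sumE w : f (average_iterate T x w) <= T%:R^-1 * \sum_(t < T) f (x t w).
  pose l := map (fun t : 'I_T => x t w) (index_enum _).
  have sl : size l = T by rewrite size_map -sum1_size -[RHS]card_ord -sum1_card;
    exact: eq_bigl.
  have l0 : l != [::] by rewrite -size_eq0 sl -lt0n.
  by have := convex_mean convex_objective l0; rewrite sl !big_map.
have iS : integ P (fun w => T%:R^-1 * \sum_(t < T) f (x t w)).
  by apply: integZ; apply: integ_sum => t; exact: (sample_mean_x t).1.
have mavg i : measurable_fun setT (fun w => average_iterate T x w 0 i).
  rewrite (_ : (fun _ => _) = (fun w => T%:R^-1 * \sum_(t < T) x t w 0 i)).
    by apply: measurable_funM => //; apply: measurable_sum => t; exact: measurable_x.
  by apply/funext => w; rewrite !mxE summxE.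
(* Integrability by squeezing: convexity bounds the value from above by the mean of the [f (x t w)],
   minimality bounds it from below by [f xstar]. *)
have ia : integ P (fun w => f (average_iterate T x w)).
  apply: (integ_le _ _ (integD (integ_norm iS) (integ_cst P `|f xstar|))).
    exact: measurable_objective_comp.
  move=> w; have h1 := sumE w; have h2 := xmin (average_iterate T x w).
  have h3 := ler_norm (T%:R^-1 * \sum_(t < T) f (x t w)).
  have h4 := ler_norm (- f xstar); rewrite normrN in h4.
  have h5 := normr_ge0 (f xstar); have h6 := normr_ge0 (T%:R^-1 * \sum_(t < T) f (x t
    w)).
  rewrite ler_norml; apply/andP; split; lra.
split=> //.
have step n : \sum_(t < n) 2 * eta * (\int[P]_w f (x t w) - f xstar - 2 * b) + D n
    <= D 0%N + eta ^+ 2 * \sum_(t < n) a2 t.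
  elim: n => [|n ih]; first by rewrite !big_ord0; lra.
  rewrite !big_ord_recr /= dist_step.
  have h : \int[P]_w f (x n w) - f xstar - 2 * b <= \int[P]_w inner n w.
    have := descent n d0; have := b1 n; have := b2 n; rewrite (sample_mean_x n).2;
      lra.
  have e2 : 0 <= 2 * eta by rewrite mulr_ge0// ltW.
  have := ler_wpM2l e2 h; lra.
have D0 : D 0%N = enorm (x0 - xstar) ^+ 2.
  by rewrite (eq_Ex _ (_ : _ =1 cst (enorm (x0 - xstar) ^+ 2))) ?Ex_cst// => w;
    rewrite run.1.
have := step T; rewrite D0 -mulr_sumr !sumrB !sumr_const card_ord => hs.
have DT : 0 <= D T by apply: Rintegral_ge0 => w _; exact: sqr_ge0.
have hE := Ex_le ia iS sumE.
rewrite ExZ in hE; last by apply: integ_sum => t; exact: (sample_mean_x t).1.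
rewrite Ex_sum in hE; last by move=> t; exact: (sample_mean_x t).1.
have hm := sum_second_moments T al.
have hm2 := ler_wpM2l (sqr_ge0 eta) hm.
set S := \sum_(t < T) _ in hE hs.
set M := a2 0%N in hm hm2 *.
rewrite -[f xstar *+ T]mulr_natr -[2 * b *+ T]mulr_natr in hs.
have h1 : 2 * eta * (S - f xstar * T%:R - 2 * b * T%:R) <=
    enorm (x0 - xstar) ^+ 2 + eta ^+ 2 * (2 * M + 2 * K * T%:R) by lra.
have eT : 0 < 2 * eta * T%:R by rewrite !mulr_gt0.
apply: (@le_trans _ _ (T%:R^-1 * S - f xstar)); first by rewrite lerD2r.
rewrite -(ler_pM2l eT).
have -> : 2 * eta * T%:R * (T%:R^-1 * S - f xstar) =
    2 * eta * (S - f xstar * T%:R) by field; rewrite gt_eqF.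
have -> : 2 * eta * T%:R * (enorm (x0 - xstar) ^+ 2 / (2 * eta * T%:R)
    + eta * (M / T%:R + K) + 2 * b) =
    enorm (x0 - xstar) ^+ 2 + eta ^+ 2 * (2 * M + 2 * K * T%:R)
    + 2 * eta * (2 * b * T%:R) by field; rewrite !gt_eqF.
lra.
Qed.

(** A quadratic majorant of the norm replaces Jensen's inequality for the square root: at
    [c = Num.sqrt d%:R] its mean is exactly [delta * Num.sqrt d%:R]. *)
Lemma noise_step_bound t w c : 0 < c ->
  enorm (delta *: u t w) <= delta * ((c^-1 * enorm (u t w) ^+ 2 + c) / 2).
Proof.
move=> c0; have e : enorm (delta *: u t w) ^+ 2 = delta ^+ 2 * enorm (u t w) ^+ 2.
  by rewrite !enorm_sqr mulr_sumr; apply: eq_bigr => i _; rewrite !mxE; ring.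
have dc : 0 < 2 * delta * c by rewrite !mulr_gt0.
rewrite -(ler_pM2l dc).
have -> : 2 * delta * c * (delta * ((c^-1 * enorm (u t w) ^+ 2 + c) / 2)) =
   delta ^+ 2 * enorm (u t w) ^+ 2 + delta ^+ 2 * c ^+ 2 by field; rewrite gt_eqF.
by rewrite -e; have := sqr_ge0 (enorm (delta *: u t w) - delta * c); lra.
Qed.

Lemma lipschitz_perturbation t (Y : Omega -> 'rV[R]_d) : (0 < d)%N ->
  integ P (fun w => F (Y w) (xi t w)) ->
  integ P (fun w => F (Y w + delta *: u t w) (xi t w)) ->
  `|\int[P]_w F (Y w + delta *: u t w) (xi t w) - \int[P]_w F (Y w) (xi t w)| <=
  L0 * delta * Num.sqrt d%:R.
Proof.
move=> d0 iY iYu; rewrite -ExB//; have iB := integB iYu iY.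
have c0 : 0 < Num.sqrt d%:R :> R by rewrite sqrtr_gt0 ltr0n.
set c := Num.sqrt _ in c0 *.
have [i2 e2] := noise_sqr_mean t.
have ib : integ P (fun w => L0 * delta * ((c^-1 * enorm (u t w) ^+ 2 + c) / 2)).
  rewrite (_ : (fun _ => _) = (fun w => L0 * delta / 2 * (c^-1 * enorm (u t w) ^+ 2 +
    c))).
    by apply: integZ; apply: integD; [exact: integZ|exact: integ_cst].
  by apply/funext => w; ring.
apply: (le_trans (le_normr_Rintegral measurableT iB)).
apply: (@le_trans _ _ (\int[P]_w (L0 * delta * ((c^-1 * enorm (u t w) ^+ 2 + c) /
  2)))).
  apply: Ex_le => //; first exact: integ_norm.
  move=> w; apply: (le_trans (sample_lipschitz _ _ _)).
  rewrite addrAC subrr add0r -mulrA; apply: (ler_wpM2l (ltW L00)).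
  exact: noise_step_bound.
rewrite (eq_Ex _ (_ : _ =1 (fun w => L0 * delta / 2 * (c^-1 * enorm (u t w) ^+ 2 +
  c)))); last first.
  by move=> w; ring.
rewrite ExZ; last by apply: integD; [exact: integZ|exact: integ_cst].
rewrite ExD; [|exact: integZ|exact: integ_cst].
rewrite ExZ// e2 Ex_cst.
have -> : d%:R = c ^+ 2 :> R by rewrite sqr_sqrtr.
by rewrite le_eqVlt; apply/orP; left; apply/eqP; field; rewrite gt_eqF.
Qed.

Lemma integ_sample_min t : integ P (fun w => F xstar (xi t w)).
Proof.
by apply: integ_sq; [exact: measurableT_comp (measurable_sample xstar) (measurable_xi
  t)|exact: sample_sqr].
Qed.

Lemma sample_mean_min t : \int[P]_w F xstar (xi t w) = f xstar.
Proof.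
have [_ ->] := @sample_mean t (fun=> xstar) (fun i => measurable_cst _)
  (integ_sample_min t).
exact: Ex_cst.
Qed.

(** * Bias of the perturbation for smooth samples *)

Section smooth.
Variable L1 : R.
Hypothesis L10 : 0 < L1.
Hypothesis smooth : smooth_samples F L1.

Local Notation grad y z := (gradient (fun y' => F y' z) y).

Lemma smooth_diff z y : differentiable (fun y' => F y' z) y.
Proof. exact: (smooth z).1. Qed.

Lemma measurable_gradient dT (T : measurableType dT) (Y : T -> 'rV[R]_d)
    (Z : T -> Xi) i :
  (forall j, measurable_fun setT (fun w => Y w 0 j)) -> measurable_fun setT Z ->
  measurable_fun setT (fun w => grad (Y w) (Z w) 0 i).
Proof.
move=> mY mZ.
pose h n w := n.+1%:R * (F (n.+1%:R^-1 *: delta_mx 0 i + Y w) (Z w) - F (Y w) (Z w)).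
apply: (measurable_fun_cvg (h := h)) => [n|w _].
  apply: measurable_funM => //; apply: measurable_funB;
    last exact: measurable_sample_comp.
  apply: measurable_sample_comp => // j.
  rewrite (_ : (fun _ => _) = (fun w => (n.+1%:R^-1 *: delta_mx 0 i : 'rV[R]_d) 0 j +
    Y w 0 j)).
    exact: measurable_funD.
  by apply/funext => w; rewrite !mxE.
rewrite mxE; apply: derive_seq; apply: diff_derivable; exact: smooth_diff.
Qed.

Lemma gradient_le_L0 z y i : `|grad y z 0 i| <= L0.
Proof.
apply: gradient_bound; [exact: (cso_convex cso z)|exact: smooth_diff|].
by move=> a b; exact: sample_lipschitz_l1.
Qed.

(** Each partial derivative at [Y] is bounded by [L0] and does not look at the coordinate of [u t]
    that multiplies it, so every summand has mean 0. *)
Lemma noise_gradient_mean t (Y : Omega -> 'rV[R]_d) :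
  (forall i j, adapted t (inl i) (fun w => Y w 0 j)) ->
  integ P (fun w => \sum_(i < d) (delta *: u t w) 0 i * grad (Y w) (xi t w) 0 i) /\
  \int[P]_w (\sum_(i < d) (delta *: u t w) 0 i * grad (Y w) (xi t w) 0 i) = 0.
Proof.
move=> aY.
have aG i : adapted t (inl i) (fun w => grad (Y w) (xi t w) 0 i).
  apply: measurable_gradient; first exact: aY.
  by apply: noise_others_xi; apply/eqP => -[].
have iG i : integ P (fun w => grad (Y w) (xi t w) 0 i).
  apply: (integ_le (adapted_measurable (aG i)) _ (integ_cst P L0)) => w.
  exact: gradient_le_L0.
have c i := coordinate_mean (aG i) (iG i).
have E w : \sum_(i < d) (delta *: u t w) 0 i * grad (Y w) (xi t w) 0 i =
    \sum_(i < d) delta * (u t w 0 i * grad (Y w) (xi t w) 0 i).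
  by apply: eq_bigr => i _; rewrite mxE mulrA.
have ii i := integZ delta (c i).1.
rewrite (funext E); split; first exact: integ_sum.
rewrite Ex_sum// big1// => i _.
by rewrite (ExZ _ (c i).1) (c i).2 mulr0.
Qed.

(** At the iterates the bias has a favorable sign: a convex function lies above its tangent, whose
    linear term has mean 0. The quadratic cost [L1 * delta ^+ 2 * d%:R] arises only at the
    minimizer. *)
Lemma smooth_bias_lower t :
  \int[P]_w F (x t w) (xi t w) <= \int[P]_w q t w.
Proof.
have [iG eG] := @noise_gradient_mean t (x t) (fun i j => @adapted_x t (inl i) t j
  (leqnn t)).
rewrite -[leLHS]addr0 -eG -ExD//; last exact: integ_sample_x.
apply: Ex_le; [by apply: integD => //; exact: integ_sample_x|exact:
  integ_query|move=> w].
have := convex_gradient_le (delta *: u t w) (cso_convex cso (xi t w)) (smooth_diff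
  (xi t w) (x t w)).
rewrite /query; lra.
Qed.

Lemma smooth_bias_upper t :
  \int[P]_w F (xstar + delta *: u t w) (xi t w) <= f xstar + L1 * delta ^+ 2 * d%:R.
Proof.
have [iG eG] := @noise_gradient_mean t (fun=> xstar) (fun i j => measurable_cst _).
have [i2 e2] := noise_sqr_mean t.
have iF := integ_sample_min t.
rewrite -e2 -(sample_mean_min t) -[\int[P]_w F xstar _]addr0 -eG -(ExD iF iG).
rewrite -(ExZ _ i2) -ExD; [|exact: integD|exact: integZ].
apply: Ex_le; [exact: integ_perturbed_min| |move=> w].
  by apply: integD; [exact: integD|exact: integZ].
have [dF [Lz LzL hL]] := smooth (xi t w).
have lG a b : enorm (grad a (xi t w) - grad b (xi t w)) <= L1 * enorm (a - b).
  by apply: (le_trans (hL a b)); rewrite ler_wpM2r// enorm_ge0.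
apply: (le_trans (smooth_upper xstar (delta *: u t w) (cso_convex cso (xi t w)) dF
  lG)).
rewrite lerD2l -mulrA; apply: (ler_wpM2l (ltW L10)).
rewrite !enorm_sqr mulr_sumr; apply: ler_sum => i _.
by rewrite mxE exprMn.
Qed.

End smooth.

End run.

(** * The rate under a common parametrization of stepsize and exploration *)

Section rate.
Context (R : realType) (d : nat) dX (Xi : measurableType dX)
  (Q : probability Xi R) (F : 'rV[R]_d -> Xi -> R) (L0 sigma : R)
  dO (Omega : measurableType dO) (P : probability Omega R)
  (u : nat -> Omega -> 'rV[R]_d) (xi : nat -> Omega -> Xi)
  (eta delta : R) (x0 xstar : 'rV[R]_d) (x : nat -> Omega -> 'rV[R]_d).
Hypothesis L00 : 0 < L0.
Hypothesis cso : convex_stochastic_objective Q F L0 sigma.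
Hypothesis noise : sampling_noise P Q u xi.
Hypothesis delta0 : 0 < delta.
Hypothesis run : residual_feedback_run F eta delta x0 u xi x.
Hypothesis xmin : forall y, objective Q F xstar <= objective Q F y.

Local Notation f := (objective Q F).
Local Notation M := (initial_second_moment P F delta u xi x).

(* Both parts of the theorem choose [eta] and [delta] so that, with [rho] the
   announced rate, [eta = 1 / (2 sqrt 2 L0 rho T)] and [d / delta^2 = rho^2 T]. *)
Lemma averaged_iterate_rate (T : nat) (b rho : R) :
  (0 < d)%N -> (0 < T)%N -> 0 < rho ->
  eta = 1 / (2 * Num.sqrt 2 * L0 * (rho * T%:R)) ->
  d%:R * delta^-1 ^+ 2 = rho ^+ 2 * T%:R ->
  1 <= rho * T%:R ->
  d%:R ^+ 2 * \int[@std_normal R]_a (a ^+ 4) <= rho ^+ 2 * T%:R ->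
  (forall t, \int[P]_w F (x t w) (xi t w) <= \int[P]_w query F delta u xi x t w + b)
    ->
  (forall t, \int[P]_w F (xstar + delta *: u t w) (xi t w) <= f xstar + b) ->
  ('E_P[fun w => f (average_iterate T x w)] - (f xstar)%:E <=
   ((Num.sqrt 2 * L0 * enorm (x0 - xstar) ^+ 2 + M / L0 + 16 * L0
     + 8 * sigma ^+ 2 / L0) * rho + 2 * b)%:E)%E.
Proof.
move=> d0 T0 rho0 etaE dE rT kT b1 b2.
have TR : 1 <= T%:R :> R by rewrite ler1n.
have T1 : 0 < T%:R :> R by rewrite ltr0n.
set q := Num.sqrt 2 in etaE *.
have q2 : q ^+ 2 = 2 by rewrite sqr_sqrtr.
have q0 : 0 <= q by exact: sqrtr_ge0.
have q1 : 1 <= q by rewrite leNgt; apply/negP => q1; move: q2; rewrite expr2; nra.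
have qn0 : 0 < q by exact: lt_le_trans q1.
have rT0 : 0 < rho * T%:R by rewrite mulr_gt0.
have eta0 : 0 < eta by rewrite etaE divr_gt0// !mulr_gt0.
have [qN LN rN TN] : [/\ q != 0, L0 != 0, rho != 0 & (T%:R : R) != 0].
  by rewrite !gt_eqF.
(* The left side is exactly [1 / T]; the factor [2 * Num.sqrt 2] in [eta] cancels the 8. *)
have al : 2 * (4 * d%:R * L0 ^+ 2 * eta ^+ 2 * delta^-1 ^+ 2) <= 1.
  have -> : 2 * (4 * d%:R * L0 ^+ 2 * eta ^+ 2 * delta^-1 ^+ 2) =
      8 * L0 ^+ 2 * eta ^+ 2 * (d%:R * delta^-1 ^+ 2) by ring.
  rewrite dE etaE.
  have -> : 8 * L0 ^+ 2 * (1 / (2 * q * L0 * (rho * T%:R))) ^+ 2 * (rho ^+ 2 * T%:R) =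
    2 / q ^+ 2 / T%:R by field; rewrite ?qN ?LN ?rN ?TN.
  by rewrite q2 divff// mul1r invf_le1.
have [iavg] := averaged_iterate_bound L00 cso noise eta0 delta0 run xmin d0 T0 al b1
  b2.
rewrite unlock -Ex_EFin// -EFinB lee_fin => /le_trans; apply; rewrite lerD2r.
have -> : \int[P]_w enorm (residual_estimator F delta u xi x 0 w) ^+ 2 = M.
  by rewrite /initial_second_moment unlock.
have M0 : 0 <= M.
  by rewrite /initial_second_moment unlock; apply: Rintegral_ge0 => w _;
    exact: sqr_ge0.
rewrite /second_moment_growth.
set kap := d%:R ^+ 2 * _ in kT *.
have -> : 8 * sigma ^+ 2 * d%:R * delta^-1 ^+ 2 = 8 * sigma ^+ 2 * (rho ^+ 2 * T%:R).
  by rewrite -dE; ring.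
rewrite etaE.
have -> : enorm (x0 - xstar) ^+ 2 / (2 * (1 / (2 * q * L0 * (rho * T%:R))) * T%:R) =
    q * L0 * enorm (x0 - xstar) ^+ 2 * rho by field; rewrite ?qN ?LN ?rN ?TN.
have -> : 1 / (2 * q * L0 * (rho * T%:R)) * (M / T%:R + (16 * L0 ^+ 2 * kap
    + 8 * sigma ^+ 2 * (rho ^+ 2 * T%:R))) =
    (2 * q)^-1 * (M / L0 / (rho * T%:R * T%:R) + 16 * L0 * (kap / (rho * T%:R))
    + 8 * sigma ^+ 2 / L0 * rho) by field; rewrite ?qN ?LN ?rN ?TN.
have h1 : M / L0 / (rho * T%:R * T%:R) <= M / L0 * rho.
  apply: ler_wpM2l; first by rewrite divr_ge0// ltW.
  have : 1 <= rho * (rho * T%:R * T%:R) by nra.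
  by rewrite -ler_pdivrMr ?mul1r ?div1r ?mulr_gt0.
(* The fourth moment term is of lower order in [T] but of higher order in [d]; [kT] is what lets it
   fit under the rate. *)
have h2 : 16 * L0 * (kap / (rho * T%:R)) <= 16 * L0 * rho.
  apply: ler_wpM2l; first by rewrite mulr_ge0// ltW.
  by rewrite ler_pdivrMr// mulrA -expr2.
have h3 : 0 <= 8 * sigma ^+ 2 / L0 * rho.
  apply: mulr_ge0 (ltW rho0); apply: divr_ge0 (ltW L00).
  by apply: mulr_ge0 => //; exact: sqr_ge0.
have p1 : 0 <= M / L0 * rho by exact: mulr_ge0 (divr_ge0 M0 (ltW L00)) (ltW rho0).
have p2 : 0 <= 16 * L0 * rho by rewrite mulr_ge0 ?mulr_ge0 ?(ltW L00) ?(ltW rho0).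
have i0 : 0 <= (2 * q)^-1 by rewrite invr_ge0 mulr_ge0.
have i1 : (2 * q)^-1 <= 1 by rewrite invf_le1 ?mulr_gt0//; lra.
set A := M / L0 / _ + _ + _.
have hA : A <= M / L0 * rho + 16 * L0 * rho + 8 * sigma ^+ 2 / L0 * rho.
  by rewrite /A; lra.
set S := M / L0 * rho + _ + _ in hA.
have S0 : 0 <= S by rewrite !addr_ge0.
have : (2 * q)^-1 * A <= S by apply: (le_trans (ler_wpM2l i0 hA)); rewrite ler_piMl.
rewrite /S; lra.
Qed.

End rate.

(** * The two choices of parameters *)

Theorem theorem14 (R : realType) :
  (exists C : R -> R -> R -> R -> R,
   forall d : nat, (0 < d)%N ->
   exists T0 : nat,
   forall (dX : measure_display) (Xi : measurableType dX)
     (Q : probability Xi R) (F : 'rV[R]_d -> Xi -> R) (L0 sigma : R)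
     (xstar x0 : 'rV[R]_d)
     (dO : measure_display) (Omega : measurableType dO)
     (P : probability Omega R)
     (u : nat -> Omega -> 'rV[R]_d) (xi : nat -> Omega -> Xi),
   0 < L0 -> 0 < sigma ->
   convex_stochastic_objective Q F L0 sigma ->
   (forall y, objective Q F xstar <= objective Q F y) ->
   sampling_noise P Q u xi ->
   forall T : nat, (T0 <= T)%N -> (0 < T)%N ->
   let eta : R := 1 / (2 * Num.sqrt 2 * L0 * Num.sqrt d%:R * T%:R `^ (3 / 4)) in
   let delta : R := 1 / T%:R `^ (1 / 4) in
   forall x : nat -> Omega -> 'rV[R]_d,
   residual_feedback_run F eta delta x0 u xi x ->
   ('E_P[fun w => objective Q F (average_iterate T x w)]
      - (objective Q F xstar)%:E
    <= (C L0 sigma (enorm (x0 - xstar))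
          (initial_second_moment P F delta u xi x)
        * (Num.sqrt d%:R * T%:R `^ (- (1 / 4))))%:E)%E)
  /\
  (exists C : R -> R -> R -> R -> R -> R,
   forall d : nat, (0 < d)%N ->
   exists T0 : nat,
   forall (dX : measure_display) (Xi : measurableType dX)
     (Q : probability Xi R) (F : 'rV[R]_d -> Xi -> R) (L0 sigma L1 : R)
     (xstar x0 : 'rV[R]_d)
     (dO : measure_display) (Omega : measurableType dO)
     (P : probability Omega R)
     (u : nat -> Omega -> 'rV[R]_d) (xi : nat -> Omega -> Xi),
   0 < L0 -> 0 < sigma ->
   convex_stochastic_objective Q F L0 sigma ->
   0 < L1 -> smooth_samples F L1 ->
   (forall y, objective Q F xstar <= objective Q F y) ->
   sampling_noise P Q u xi ->
   forall T : nat, (T0 <= T)%N -> (0 < T)%N ->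
   let eta : R := 1 / (2 * Num.sqrt 2 * L0 * d%:R `^ (2 / 3) * T%:R `^ (2 / 3)) in
   let delta : R := 1 / (d%:R `^ (1 / 6) * T%:R `^ (1 / 6)) in
   forall x : nat -> Omega -> 'rV[R]_d,
   residual_feedback_run F eta delta x0 u xi x ->
   ('E_P[fun w => objective Q F (average_iterate T x w)]
      - (objective Q F xstar)%:E
    <= (C L0 L1 sigma (enorm (x0 - xstar))
          (initial_second_moment P F delta u xi x)
        * (d%:R `^ (2 / 3) * T%:R `^ (- (1 / 3))))%:E)%E).
Proof.
have powX (n k m : nat) (p : R) : (0 < n)%N -> p * m%:R = k%:R -> 
    (n%:R : R) `^ p ^+ m = n%:R ^+ k.
  move=> n0 e; rewrite -powR_mulrn ?powR_ge0// -powRrM e powR_mulrn//.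
have pow_ge1 (n : nat) (p : R) : (0 < n)%N -> 0 <= p -> 1 <= (n%:R : R) `^ p.
  move=> n0 p0; rewrite -[leLHS](powRr0 (n%:R : R)).
  by apply: ler_powR; rewrite ?ler1n.
pose kap (d : nat) : R := d%:R ^+ 2 * \int[@std_normal R]_a (a ^+ 4).
have kap0 d : 0 <= kap d.
  apply: mulr_ge0; first exact: sqr_ge0.
  by apply: Rintegral_ge0 => a _; rewrite (exprM a 2 2) sqr_ge0.
(* This fixes the threshold on [T]. The rate satisfies [rho ^+ 2 * T >= T^(1/2)] in the first part
   and [>= T^(1/3)] in the second, so [k] is 2 and 3 respectively. *)
have kapT (d k T : nat) (tau : R) : 0 <= tau -> (0 < k)%N -> tau ^+ k = T%:R ->
    (Num.Def.archi_bound (kap d ^+ k) <= T)%N -> kap d <= tau.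
  move=> tau0 k0 e bT.
  rewrite -(@ler_pXn2r _ k) ?nnegrE// e; apply: ltW.
  apply: (lt_le_trans (archi_boundP (exprn_ge0 k (kap0 d)))).
  by rewrite ler_nat.
split.
(* The last summand is the bias: here [L0 * delta * Num.sqrt d%:R] equals [L0 * rho] exactly, and it
   counts twice. *)
- exists (fun L0 sigma r M => Num.sqrt 2 * L0 * r ^+ 2 + M / L0 + 16 * L0
     + 8 * sigma ^+ 2 / L0 + 2 * L0).
  move=> d d0; exists (Num.Def.archi_bound (kap d ^+ 2)).
  move=> dX Xi Q F L0 sigma xstar x0 dO Omega P u xi L00 s0 cso xmin noise T T0 Tpos.
  move=> eta delta x run.
  (* In terms of [tau] and [s] all the real powers become integer powers, within reach of
     [field]. *)
  pose tau : R := T%:R `^ (1 / 4); pose s : R := Num.sqrt d%:R.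
  have tau1 : 1 <= tau by apply: pow_ge1.
  have tau0 : 0 < tau by exact: lt_le_trans tau1.
  have s2 : s ^+ 2 = d%:R by rewrite sqr_sqrtr.
  have sp : 0 < s by rewrite sqrtr_gt0 ltr0n.
  have s1 : 1 <= s.
    rewrite -(@ler_pXn2r _ 2)// ?nnegrE ?(ltW sp)// s2 expr1n ler1n//.
  have t4 : tau ^+ 4 = T%:R by rewrite (powX _ 1)// ?expr1//; lra.
  have t3 : T%:R `^ (3 / 4) = tau ^+ 3.
    by rewrite -powR_mulrn ?powR_ge0// -powRrM; congr (_ `^ _); lra.
  have delta0 : 0 < delta by rewrite divr_gt0.
  have -> : Num.sqrt d%:R * T%:R `^ (- (1 / 4)) = s / tau by rewrite powRN.
  have etaE : eta = 1 / (2 * Num.sqrt 2 * L0 * (s / tau * T%:R)).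
    by rewrite /eta t3 -t4 -/s; congr (1 / _); field; rewrite gt_eqF.
  have dE : d%:R * delta^-1 ^+ 2 = (s / tau) ^+ 2 * T%:R.
    by rewrite -s2 -t4 /delta -/tau; field; rewrite gt_eqF.
  have rE : s / tau * T%:R = s * tau ^+ 3 by rewrite -t4; field; rewrite gt_eqF.
  have rE2 : (s / tau) ^+ 2 * T%:R = s ^+ 2 * tau ^+ 2.
    by rewrite -t4; field; rewrite gt_eqF.
  have kT : kap d <= tau ^+ 2.
    apply: (kapT d 2 T) => //; first exact: sqr_ge0.
    by rewrite -exprM.
  have lb t (Y : Omega -> 'rV[R]_d) := @lipschitz_perturbation _ _ _ _ _ _ _ _ _ _ _
    _ _ _
    L00 cso noise delta0 t Y d0.
  apply: (le_trans (averaged_iterate_rate (rho := s / tau) (b := L0 * delta * s)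
    L00 cso noise delta0 run xmin d0 Tpos _ etaE dE _ _ _ _)).
  + by rewrite divr_gt0.
  + rewrite rE; apply: mulr_ege1 => //; exact: exprn_ege1.
  + rewrite rE2; apply: (le_trans kT); rewrite ler_peMl ?sqr_ge0//; exact: exprn_ege1.
  + move=> t; have := lb t (x t) (integ_sample_x xstar L00 cso noise delta0 run t)
      (integ_query xstar L00 cso noise delta0 run t).
    by move=> /ler_normlP[h _]; rewrite /query -/s in h *; lra.
  + move=> t; have := lb t (fun=> xstar) (integ_sample_min xstar L00 cso noise t)
      (integ_perturbed_min delta xstar L00 cso noise t).
    by rewrite (sample_mean_min xstar L00 cso noise) => /ler_normlP[_ h];
      rewrite -/s in h; lra.
  + by rewrite lee_fin le_eqVlt; apply/orP; left; apply/eqP; rewrite /delta -/tau;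
    ring.
(* In this case the bias [L1 * delta ^+ 2 * d%:R] is exactly [L1 * rho], whence the summand
   [2 * L1]. *)
- exists (fun L0 L1 sigma r M => Num.sqrt 2 * L0 * r ^+ 2 + M / L0 + 16 * L0
     + 8 * sigma ^+ 2 / L0 + 2 * L1).
  move=> d d0; exists (Num.Def.archi_bound (kap d ^+ 3)).
  move=> dX Xi Q F L0 sigma L1 xstar x0 dO Omega P u xi L00 s0 cso L10 sm xmin noise
    T T0 Tpos.
  move=> eta delta x run.
  pose tau : R := T%:R `^ (1 / 6); pose e : R := d%:R `^ (1 / 6).
  have tau1 : 1 <= tau by apply: pow_ge1.
  have tau0 : 0 < tau by exact: lt_le_trans tau1.
  have e1 : 1 <= e by apply: pow_ge1.
  have e0 : 0 < e by exact: lt_le_trans e1.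
  have e6 : e ^+ 6 = d%:R by rewrite (powX _ 1)// ?expr1//; lra.
  have t6 : tau ^+ 6 = T%:R by rewrite (powX _ 1)// ?expr1//; lra.
  have t4 : T%:R `^ (2 / 3) = tau ^+ 4.
    by rewrite -powR_mulrn ?powR_ge0// -powRrM; congr (_ `^ _); lra.
  have e4 : d%:R `^ (2 / 3) = e ^+ 4.
    by rewrite -powR_mulrn ?powR_ge0// -powRrM; congr (_ `^ _); lra.
  have t2 : T%:R `^ (1 / 3) = tau ^+ 2.
    by rewrite -powR_mulrn ?powR_ge0// -powRrM; congr (_ `^ _); lra.
  have delta0 : 0 < delta by rewrite divr_gt0// mulr_gt0.
  have -> : d%:R `^ (2 / 3) * T%:R `^ (- (1 / 3)) = e ^+ 4 / tau ^+ 2.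
    by rewrite powRN e4 t2.
  have nz : (tau != 0) && (e != 0) by rewrite !gt_eqF.
  have etaE : eta = 1 / (2 * Num.sqrt 2 * L0 * (e ^+ 4 / tau ^+ 2 * T%:R)).
    by rewrite /eta t4 e4 -t6; congr (1 / _); field; rewrite gt_eqF.
  have dE : d%:R * delta^-1 ^+ 2 = (e ^+ 4 / tau ^+ 2) ^+ 2 * T%:R.
    by rewrite -e6 -t6 /delta -/tau -/e; field.
  have rE : e ^+ 4 / tau ^+ 2 * T%:R = e ^+ 4 * tau ^+ 4.
    by rewrite -t6; field; rewrite gt_eqF.
  have rE2 : (e ^+ 4 / tau ^+ 2) ^+ 2 * T%:R = e ^+ 8 * tau ^+ 2.
    by rewrite -t6; field; rewrite gt_eqF.
  have kT : kap d <= tau ^+ 2.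
    apply: (kapT d 3 T) => //; first exact: sqr_ge0.
    by rewrite -exprM.
  apply: (le_trans (averaged_iterate_rate (rho := e ^+ 4 / tau ^+ 2)
    (b := L1 * delta ^+ 2 * d%:R)
    L00 cso noise delta0 run xmin d0 Tpos _ etaE dE _ _ _ _)).
  + by rewrite divr_gt0// exprn_gt0.
  + by rewrite rE; apply: mulr_ege1; exact: exprn_ege1.
  + rewrite rE2; apply: (le_trans kT); rewrite ler_peMl ?sqr_ge0//; exact: exprn_ege1.
  + move=> t; apply: (le_trans (smooth_bias_lower xstar L00 cso noise delta0 run sm
    t)).
    by rewrite lerDl !mulr_ge0 ?sqr_ge0 ?(ltW L10).
  + by move=> t; exact: (smooth_bias_upper delta xstar L00 cso noise L10 sm t).
  + rewrite lee_fin le_eqVlt; apply/orP; left; apply/eqP.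
    by rewrite -e6 /delta -/tau -/e; field; rewrite !gt_eqF.
Qed.
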